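(* There is a universal constant $C>0$ such that the following holds. Let $d\ge 1$ and $L\ge 3$ be integers, let $G=\mathbf{Z}^d/L\mathbf{Z}^d$, let $r\ge 1$ be an integer and let $\rho=r/L^d$. Then the relaxation time $\tau_1$ of the zero range process with rate $1$ on $G$ with $r$ particles satisfies $$\tau_1\le C\,d^2(\rho+1)^2L^2 .$$ *)

(* Defs.v *)
From Stdlib Require Import Rdefinitions.
From HB Require Import structures.
From mathcomp Require Import all_boot all_order all_algebra.
From mathcomp Require Import boolp classical_sets reals.
From mathcomp Require Import Rstruct.

Set Implicit Arguments.
Unset Strict Implicit.
Unset Printing Implicit Defensive.

Import Order.TTheory GRing.Theory Num.Theory.

Definition site (d L : nat) := {ffun 'I_d -> 'I_L}.

Definition adj (d L : nat) (x y : site d L) : bool :=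
  [exists i : 'I_d,
     [forall j : 'I_d, (j != i) ==> (x j == y j)] &&
     (((y i : nat) == ((x i).+1 %% L)%N) || ((x i : nat) == ((y i).+1 %% L)%N))].

(* Particle configurations with at most r particles per site (values in
   'I_r.+1); the state space of the process is [configs d L r], i.e. the
   configurations with exactly r particles in total. *)
Definition config (d L r : nat) := {ffun site d L -> 'I_r.+1}.

Definition configs (d L r : nat) : {set config d L r} :=
  [set eta : config d L r | (\sum_(x : site d L) (eta x : nat) == r)%N].

Local Open Scope ring_scope.
Local Open Scope classical_set_scope.

Definition move (d L r : nat) (eta : config d L r) (x y : site d L)
  : config d L r :=
  [ffun z => if z == x then inord (eta x).-1
             else if z == y then inord (eta y).+1 else eta z].

(* Transition rates of the rate-1 zero range process: every nonempty site
   x emits a particle at rate 1, which jumps to a uniformly chosen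
   neighbour y of x. *)
Definition zrp_rate (d L r : nat) (eta xi : config d L r) : R :=
  \sum_(x : site d L) \sum_(y : site d L |
       [&& adj x y, (0 < eta x)%N & move eta x y == xi])
     (#|[set z | adj x z]|%:R)^-1.

Definition stationary (d L r : nat) (pi : config d L r -> R) : Prop :=
  [/\ (forall eta, 0 <= pi eta),
      (forall eta, eta \notin configs d L r -> pi eta = 0),
      \sum_eta pi eta = 1 &
      forall xi, \sum_eta pi eta * zrp_rate eta xi
                 = pi xi * \sum_eta zrp_rate xi eta].

Definition expect (d L r : nat) (pi : config d L r -> R)
  (f : config d L r -> R) : R := \sum_eta pi eta * f eta.

Definition variance (d L r : nat) (pi : config d L r -> R)
  (f : config d L r -> R) : R :=
  \sum_eta pi eta * (f eta - expect pi f) ^+ 2.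

Definition dirichlet (d L r : nat) (pi : config d L r -> R)
  (f : config d L r -> R) : R :=
  2^-1 * \sum_eta \sum_xi pi eta * zrp_rate eta xi * (f xi - f eta) ^+ 2.

Definition spectral_gap (d L r : nat) (pi : config d L r -> R) : R :=
  inf [set dirichlet pi f / variance pi f
      | f in [set f : config d L r -> R | 0 < variance pi f]].

Definition relaxation_time (d L r : nat) (pi : config d L r -> R) : R :=
  (spectral_gap pi)^-1.

(* Main.v *)
Require Import Defs.
From Stdlib Require Import Rdefinitions.
From mathcomp Require Import all_boot all_order all_algebra.
From mathcomp Require Import boolp classical_sets reals Rstruct.
From mathcomp Require Import ring lra zify.
Import Order.TTheory GRing.Theory Num.Theory.
Local Open Scope ring_scope.

Set Implicit Arguments.
Unset Strict Implicit.
Unset Printing Implicit Defensive.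

(**
The stationary law is uniform. A jump from [x] to [y] turns [zeta + delta_x]
into [zeta + delta_y], where [zeta] has one particle less, so the Dirichlet form
is a sum over [zeta] of Dirichlet forms of the random walk for the function
[x |-> f (zeta + delta_x)]. By the Poincare inequality of the torus, with
constant of order [d L^2], it suffices to bound the variance of [f] by
[K (1 + rho)^2] times the sum over [zeta] and [x] of
[(f (zeta + delta_x) - c zeta)^2].

This bound holds for every finite set of [m] sites carrying [s] particles, with
[h = (s + m) / m] in place of [1 + rho], and goes by induction on [m]. Reveal one
site [z], chosen with probability proportional to [eta z + 1]; since
[sum_z (eta z + 1) = s + m] is constant, the other sites keep the uniform law.
The variance of the conditional expectation is controlled by a one-dimensional
weighted Poincare inequality for the occupation number of one site, with constant
of order [h^2]. The size bias makes [h^2] a supermartingale along the successive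
revelations, even when a few sites carry most of the particles, and its drift
absorbs the contribution of each step. Hence the constant [K] does not
deteriorate with [m].
*)

(** * Poincare inequalities for the occupation number of one site *)

Lemma abel_sum (F : comPzRingType) (q u : nat -> F) N :
  \sum_(k < N) (q k - q k.+1) * u k =
  q 0%N * u 0%N - q N * u N + \sum_(k < N) q k.+1 * (u k.+1 - u k).
Proof.
elim: N => [|N IH]; first by rewrite !big_ord0; ring.
by rewrite !big_ord_recr /= IH; ring.
Qed.

Lemma sqr_increment_le (F : realFieldType) (u : nat -> F) j n :
  (u (j + n)%N - u j) ^+ 2 <= n%:R * \sum_(l < n) (u (j + l).+1 - u (j + l)%N) ^+ 2.
Proof.
(* Cauchy-Schwarz, one increment at a time: [(m + 1) (b^2 / m + a^2) - (b + a)^2 = (b - m a)^2 /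
   m]. *)
have step (m a b B : F) : 0 < m -> b ^+ 2 <= m * B ->
    (b + a) ^+ 2 <= (m + 1) * (B + a ^+ 2).
  move=> m0 h; rewrite -(ler_pM2l m0).
  by have := sqr_ge0 (b - m * a); nra.
elim: n => [|n IH]; first by rewrite addn0 big_ord0 subrr expr0n mulr0.
rewrite big_ord_recr /= addnS.
have -> : u (j + n).+1 - u j = (u (j + n)%N - u j) + (u (j + n).+1 - u (j + n)%N) by ring.
case: n IH => [|n] IH; first by rewrite addn0 big_ord0 subrr !add0r mul1r.
by rewrite -[n.+2%:R]natr1; apply: step; rewrite ?ltr0n.
Qed.

(* [p] is, up to normalization, the law of the number of particles at one of [m]
   sites carrying [s] particles; the constant is sharp, the identity being an
   eigenfunction. *)
Lemma birth_death_poincare (F : realFieldType) (p psi : nat -> F) (s m : F) N :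
  0 < m ->
  (forall k, 0 <= p k) -> p N = 0 ->
  (forall k, (k < N)%N -> p k * (s - k%:R) = p k.+1 * (s - k%:R + m - 2)) ->
  \sum_(k < N) p k * psi k = 0 ->
  \sum_(k < N) p k * psi k ^+ 2 <=
  \sum_(k < N) p k.+1 * k.+1%:R * ((s - k%:R + m - 2) / m) * (psi k.+1 - psi k) ^+ 2.
Proof.
move=> m0 p0 pN prec cen.
(* [Q] accumulates the squared increments of [psi]. Since
   [(psi k - psi j)^2 <= (k - j) (Q k - Q j)], the variance of [psi] is at most the covariance of
   [Q] with the identity, which Abel summation computes exactly. *)
pose Q k := \sum_(l < k) (psi l.+1 - psi l) ^+ 2.
(* [rr k] is the sum of [p j (j - s / m)] over [k <= j < N]. It vanishes at 0 through its factor [k]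
   and at [N] through [pN], whence [meanE]. *)
pose rr k := p k * k%:R * ((s - k%:R + m - 1) / m).
have rrE k : (k < N)%N -> rr k - rr k.+1 = p k * (k%:R - s / m).
  move=> /prec; rewrite /rr -[k.+1%:R]natr1 => e.
  have mn : m != 0 by rewrite gt_eqF.
  apply/eqP; rewrite -subr_eq0.
  have -> : p k * k%:R * ((s - k%:R + m - 1) / m)
      - p k.+1 * (k%:R + 1) * ((s - (k%:R + 1) + m - 1) / m) - p k * (k%:R - s / m)
    = (k%:R + 1) / m * (p k * (s - k%:R) - p k.+1 * (s - k%:R + m - 2)) by field.
  by rewrite e subrr mulr0.
have RE : \sum_(k < N) p k * (k%:R - s / m) * Q k =
    \sum_(k < N) p k.+1 * k.+1%:R * ((s - k%:R + m - 2) / m) * (psi k.+1 - psi k) ^+ 2.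
  transitivity (\sum_(k < N) (rr k - rr k.+1) * Q k).
    by apply: eq_bigr => k _; rewrite rrE.
  rewrite abel_sum {1}/rr {1}/rr pN !(mul0r, mulr0) subrr add0r.
  apply: eq_bigr => k _; rewrite /rr /Q big_ord_recr /= -natr1.
  by congr (_ * _); [congr (_ * (_ / _)); ring|ring].
have meanE : \sum_(k < N) p k * (k%:R - s / m) = 0.
  transitivity (\sum_(k < N) (rr k - rr k.+1) * 1).
    by apply: eq_bigr => k _; rewrite rrE // mulr1.
  rewrite (abel_sum rr (fun=> 1)) {1}/rr {1}/rr pN !(mul0r, mulr0) subrr add0r.
  by rewrite big1 // => k _; rewrite subrr mulr0.
have pairle j k : (psi k - psi j) ^+ 2 <= (k%:R - j%:R) * (Q k - Q j).
  wlog jk : j k / (j <= k)%N.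
    move=> H; case: (leqP j k) => [/H //|/ltnW/H].
    by rewrite -[X in X ^+ 2]opprB sqrrN -[Q j - _]opprB -[j%:R - _]opprB mulrNN.
  rewrite -(subnKC jk); move: (k - j)%N => n.
  rewrite natrD addrAC subrr add0r /Q big_split_ord /= addrAC subrr add0r.
  exact: sqr_increment_le.
rewrite -RE.
pose P := \sum_(k < N) p k.
have P0 : 0 <= P by apply: sumr_ge0.
case: (ltrgtP 0 P) P0 => // [Ppos _|Pz _]; last first.
  have pz (k : 'I_N) : p k = 0.
    by apply/eqP; move: (psumr_eq0P (fun (i : 'I_N) _ => p0 i) (esym Pz)) => /(_ k isT) ->.
  by rewrite !big1 // => k _; rewrite pz !mul0r.
rewrite -(ler_pM2l Ppos).
(* Symmetrization: the double sum is twice the unnormalized covariance. It is used for [psi] with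
   itself and for the centred identity with [Q]. *)
have dbl (u v : nat -> F) : \sum_(j < N) \sum_(k < N) p j * p k * ((u k - u j) * (v k - v j)) =
   2 * (P * \sum_(k < N) p k * (u k * v k) - (\sum_(k < N) p k * u k) * (\sum_(k < N) p k * v k)).
  transitivity (\sum_(j < N) (p j * (\sum_(k < N) p k * (u k * v k))
     + p j * (u j * v j) * P
     - p j * u j * (\sum_(k < N) p k * v k) - p j * v j * (\sum_(k < N) p k * u k))).
    apply: eq_bigr => j _; rewrite /P !mulr_sumr -!big_split /= -!sumrB.
    by apply: eq_bigr => k _; ring.
  by rewrite !sumrB big_split /= -!mulr_suml -/P; ring.
have h1 := dbl psi psi; have h2 := dbl (fun k => k%:R - s / m) Q.
rewrite cen mulr0 subr0 in h1; rewrite meanE mul0r subr0 in h2.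
have : \sum_(j < N) \sum_(k < N) p j * p k * ((psi k - psi j) * (psi k - psi j)) <=
  \sum_(j < N) \sum_(k < N) p j * p k * (((k%:R - s / m) - (j%:R - s / m)) * (Q k - Q j)).
  apply: ler_sum => j _; apply: ler_sum => k _; apply: ler_wpM2l; first exact: mulr_ge0.
  rewrite -expr2; apply: (le_trans (pairle j k)).
  by rewrite opprB addrA addrNK.
rewrite h1 h2 ler_pM2l ?ltr0n // ler_pM2l ?ltr0n // ler_pM2l //.
have -> : \sum_(k < N) p k * (psi k * psi k) = \sum_(k < N) p k * psi k ^+ 2.
  by apply: eq_bigr => k _; rewrite expr2.
suff -> : \sum_(k < N) p k * ((k%:R - s / m) * Q k) = \sum_(k < N) p k * (k%:R - s / m) * Q k by [].
by apply: eq_bigr => k _; rewrite mulrA.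
Qed.

(** The weight [k + 1] comes from the size-biased choice of the site. With [h = (s + m) / m], the
    unweighted variance is at most [h] times the sum on the right. The tail of [p] is at most a
    multiple of [h] times its point mass, so the extra weight costs only one more factor [h]. *)
Lemma weighted_birth_death_poincare (F : realFieldType) (p psi : nat -> F) (s m : F) N :
  2 <= m -> 0 <= s ->
  (forall k, 0 <= p k) -> (forall k : nat, s < k%:R -> p k = 0) -> s < N%:R ->
  (forall k, p k * (s - k%:R) = p k.+1 * (s - k%:R + m - 2)) ->
  \sum_(k < N) p k * psi k = 0 ->
  \sum_(k < N) p k * k.+1%:R * psi k ^+ 2 <=
  20 * ((s + m) / m) ^+ 2 * \sum_(k < N) p k.+1 * k.+1%:R * (psi k.+1 - psi k) ^+ 2.
Proof.
move=> m2 s0 p0 ps sN prec cen.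
have m0 : 0 < m by lra.
have pN : p N = 0 by apply: ps.
have Vle := birth_death_poincare m0 p0 pN (fun k _ => prec k) cen.
set V := \sum_(k < N) p k * psi k ^+ 2 in Vle.
set E := \sum_(k < N) p k.+1 * k.+1%:R * (psi k.+1 - psi k) ^+ 2.
set X := \sum_(k < N) _.
pose h := (s + m) / m; pose H := (s + m - 1) / (m - 1).
have h0 : 0 < h by apply: divr_gt0; lra.
have H0 : 0 < H by apply: divr_gt0; lra.
have Hh : H <= 2 * h.
  rewrite /H /h mulrA ler_pdivlMr // mulrAC ler_pdivrMr; last lra.
  by nra.
have VE : V <= h * E.
  apply: (le_trans Vle); rewrite /E mulr_sumr; apply: ler_sum => k _.
  rewrite -[X in X <= _]mulrA [X in _ <= X]mulrCA -mulrA.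
  case: (ltrP s k.+1%:R) => [/ps -> | ks]; first by rewrite !mul0r.
  rewrite -[X in _ <= X]mulrA; apply: ler_wpM2l => //; apply: ler_wpM2l => //.
  rewrite mulrC [X in _ <= X]mulrC; apply: ler_wpM2l; first exact: sqr_ge0.
  have : 0 <= k%:R :> F by [].
  by rewrite /h ler_pM2r ?invr_gt0 //; lra.
(* [q k] is the tail [p k + p (k + 1) + ...]. *)
pose q k := p k * ((s - k%:R + m - 1) / (m - 1)).
have qE k : q k - q k.+1 = p k.
  rewrite /q -[k.+1%:R]natr1; apply/eqP; rewrite -subr_eq0.
  have m1 : m - 1 != 0 by rewrite gt_eqF //; lra.
  have -> : p k * ((s - k%:R + m - 1) / (m - 1))
      - p k.+1 * ((s - (k%:R + 1) + m - 1) / (m - 1)) - p k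
    = (m - 1)^-1 * (p k * (s - k%:R) - p k.+1 * (s - k%:R + m - 2)) by field.
  by rewrite prec subrr mulr0.
have qle k : q k <= H * p k.
  rewrite /q mulrC; apply: ler_wpM2r => //; rewrite /H ler_pM2r ?invr_gt0; last lra.
  by have : 0 <= k%:R :> F by []; lra.
have pdec k : p k.+1 <= p k.
  case: (ltrP s k.+1%:R) => [/ps -> // | ks].
  have sk : 0 < s - k%:R by move: ks; rewrite -natr1; lra.
  rewrite -(ler_pM2r sk) prec; apply: ler_wpM2l => //; lra.
have shift (u : nat -> F) : u N = 0 -> \sum_(k < N) u k = u 0%N + \sum_(k < N) u k.+1.
  move=> uN; transitivity (\sum_(k < N.+1) u k); last by rewrite big_ord_recl.
  by rewrite big_ord_recr /= uN addr0.
(* Abel summation against [q] trades the weight [k + 1] for an increment of [psi ^ 2]. *)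
have XE : X = \sum_(k < N) q k * psi k ^+ 2 +
    \sum_(k < N) q k.+1 * k.+1%:R * (psi k.+1 ^+ 2 - psi k ^+ 2).
  transitivity (\sum_(k < N) (q k - q k.+1) * (k.+1%:R * psi k ^+ 2)).
    by apply: eq_bigr => k _; rewrite qE mulrA.
  have qN : q N = 0 by rewrite /q pN mul0r.
  rewrite (abel_sum q (fun k => k.+1%:R * psi k ^+ 2)) qN mul0r subr0.
  rewrite (shift (fun k => q k * psi k ^+ 2)) ?qN ?mul0r // mul1r -addrA -big_split /=.
  by congr (_ + _); apply: eq_bigr => k _; rewrite -[k.+2%:R]natr1; ring.
have part1 : \sum_(k < N) q k * psi k ^+ 2 <= H * V.
  rewrite /V mulr_sumr; apply: ler_sum => k _; rewrite mulrA.
  by apply: ler_wpM2r; [exact: sqr_ge0|exact: qle].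
have bound1 : \sum_(k < N) p k.+1 * k.+1%:R * psi k.+1 ^+ 2 <= X.
  have e (u : nat -> F) : u N = 0 -> 0 <= u 0%N ->
      \sum_(k < N) u k.+1 <= \sum_(k < N) u k.
    by move=> uN u0; rewrite (shift _ uN) lerDr.
  apply: (le_trans (e (fun k => p k * k%:R * psi k ^+ 2) _ _)).
  - by rewrite pN !mul0r.
  - by rewrite mulr0 mul0r.
  apply: ler_sum => k _; apply: ler_wpM2r; first exact: sqr_ge0.
  by apply: ler_wpM2l => //; rewrite ler_nat.
have bound2 : \sum_(k < N) p k.+1 * k.+1%:R * psi k ^+ 2 <= X.
  apply: ler_sum => k _; apply: ler_wpM2r; first exact: sqr_ge0.
  by apply: ler_wpM2r.
have part2 : \sum_(k < N) q k.+1 * k.+1%:R * (psi k.+1 ^+ 2 - psi k ^+ 2) <=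
    2 * H ^+ 2 * E + 4^-1 * (\sum_(k < N) p k.+1 * k.+1%:R * psi k.+1 ^+ 2
       + \sum_(k < N) p k.+1 * k.+1%:R * psi k ^+ 2).
  rewrite /E -big_split !mulr_sumr -big_split /=; apply: ler_sum => k _.
  have q0 : 0 <= q k.+1.
    case: (ltrP s k.+1%:R) => [/ps pk | ks]; first by rewrite /q pk mul0r.
    by apply: mulr_ge0 => //; apply: divr_ge0; lra.
  (* Young's inequality for [(a - b) (a + b)], with a parameter proportional to [H]: after
     [q <= H p] the squares come with coefficient 1/4, and together they return at most [X / 2]. *)
  have amgm (a b : F) : a ^+ 2 - b ^+ 2 <=
      2 * H * (a - b) ^+ 2 + (4 * H)^-1 * (a ^+ 2 + b ^+ 2).
    rewrite -subr_ge0 -(pmulr_rge0 _ (_ : 0 < 8 * H)); last by rewrite mulr_gt0.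
    have -> : 8 * H * (2 * H * (a - b) ^+ 2 + (4 * H)^-1 * (a ^+ 2 + b ^+ 2)
         - (a ^+ 2 - b ^+ 2)) = (4 * H * (a - b) - (a + b)) ^+ 2 + (a - b) ^+ 2.
      by field; rewrite gt_eqF.
    by rewrite addr_ge0 ?sqr_ge0.
  have -> : 2 * H ^+ 2 * (p k.+1 * k.+1%:R * (psi k.+1 - psi k) ^+ 2) +
     4^-1 * (p k.+1 * k.+1%:R * psi k.+1 ^+ 2 + p k.+1 * k.+1%:R * psi k ^+ 2) =
     (H * p k.+1 * k.+1%:R) * (2 * H * (psi k.+1 - psi k) ^+ 2
        + (4 * H)^-1 * (psi k.+1 ^+ 2 + psi k ^+ 2)).
    by field; rewrite gt_eqF.
  apply: (@le_trans _ _ (q k.+1 * k.+1%:R * (2 * H * (psi k.+1 - psi k) ^+ 2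
        + (4 * H)^-1 * (psi k.+1 ^+ 2 + psi k ^+ 2)))).
    by apply: ler_wpM2l => //; apply: mulr_ge0.
  apply: ler_wpM2r; last by apply: ler_wpM2r => //; apply: qle.
  have H1 : 0 <= (4 * H)^-1 by rewrite invr_ge0 mulr_ge0 // ltW.
  by rewrite addr_ge0 // mulr_ge0 ?addr_ge0 ?sqr_ge0 // mulr_ge0 // ltW.
have E0 : 0 <= E.
  by apply: sumr_ge0 => k _; rewrite mulr_ge0 ?sqr_ge0 ?mulr_ge0.
have HV : H * V <= 2 * h ^+ 2 * E.
  apply: (@le_trans _ _ (H * (h * E))); first by rewrite ler_pM2l.
  by rewrite mulrA expr2 mulrA; apply: ler_wpM2r => //; apply: ler_wpM2r => //; rewrite ltW.
have H2 : H ^+ 2 * E <= 4 * h ^+ 2 * E.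
  apply: ler_wpM2r => //; have -> : 4 * h ^+ 2 = (2 * h) ^+ 2 by ring.
  by rewrite !expr2; apply: ler_pM => //; apply: ltW.
rewrite -/h.
(* Altogether [X <= 2 h^2 E + 8 h^2 E + X / 2], whence the constant 20. *)
move: part1 part2 bound1 bound2 HV H2; rewrite -!mulrA; lra.
Qed.

(** * The size-biased choice of a site *)

(* The supermartingale property of [h^2], with a quantitative gain. It rests on
   expanding [u (1 - u)^2] around [v = 1 / m], where
   [u (1 - u)^2 = tangent - (u - v)^2 (2 - 2 v - u)]. *)
Lemma size_biased_slack (F : realFieldType) (I : finType) (P : pred I)
    (u rr : I -> F) (b : F) (m : nat) :
  (2 <= m)%N -> #|P| = m.-1 ->
  (forall z, P z -> 0 <= u z <= 1) -> 0 <= b -> b + \sum_(z | P z) u z <= 1 ->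
  (forall z, P z -> rr z <= u z) ->
  (forall z, P z -> rr z * (1 - u z) <= 2 * b * u z) ->
  \sum_(z | P z) u z * (1 - u z) ^+ 2
    + ((m%:R - 1) / m%:R) ^+ 2 / 32 * (b + \sum_(z | P z) rr z)
  <= ((m%:R - 1) / m%:R) ^+ 2.
Proof.
move=> m2 cP u01 b0 sum1 ru rb.
have m0 : (0 < m)%N by apply: leq_trans m2.
have mF : 2 <= m%:R :> F by rewrite (ler_nat _ 2).
pose v : F := m%:R^-1.
have v0 : 0 < v by rewrite invr_gt0; lra.
have mv : m%:R * v = 1 by rewrite mulfV // gt_eqF //; lra.
have -> : (m%:R - 1) / m%:R = 1 - v by rewrite mulrBl mul1r mv.
set s := \sum_(z | P z) u z in sum1 *.
have cst (c : F) : \sum_(z | P z) c = (m%:R - 1) * c.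
  by rewrite sumr_const cP -[LHS]mulr_natl -subn1 natrB.
have s0 : 0 <= s by apply: sumr_ge0 => z /u01 /andP[].
(* The tangent argument below uses [v <= 1 / 4]. For [m] equal to 2 or 3, the maximum 4/27 of
   [u (1 - u)^2], attained at 1/3, is small enough. *)
case: (leqP 4 m) => [m4|]; last first.
  move=> m4.
  have h1 : \sum_(z | P z) u z * (1 - u z) ^+ 2 <= (m%:R - 1) * (4 / 27).
    rewrite -cst; apply: ler_sum => z /u01 /andP[z0 z1].
    have -> : 4 / 27 = u z * (1 - u z) ^+ 2 + (u z - 3^-1) ^+ 2 * (4 / 3 - u z) by field.
    by rewrite lerDl mulr_ge0 ?sqr_ge0 //; lra.
  have h2 : \sum_(z | P z) rr z <= s by apply: ler_sum.
  have h3 : b + \sum_(z | P z) rr z <= 1 by lra.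
  have v1 : (1 - v) ^+ 2 / 32 * (b + \sum_(z | P z) rr z) <= (1 - v) ^+ 2 / 32.
    by rewrite ger_pMr //; apply: divr_gt0 => //; rewrite exprn_gt0 // subr_gt0 invf_lt1; lra.
  have : m = 2%N \/ m = 3%N by case: (m) m2 m4 => [|[|[|[|]]]] //; [left|right].
  rewrite /v in v1 *; by case=> mE; rewrite mE in h1 v1 *; nra.
have v4 : v <= 4^-1.
  by rewrite lef_pV2 ?posrE ?ltr0n // (ler_nat _ 4).
(* A pointwise bound affine in [u z]: the tangent at [v], of slope [(1 - v) (1 - 3 v)], plus a term
   in [b] that pays for [rr z]. Summation then only involves [s <= 1 - b]. *)
have pt z : P z -> u z * (1 - u z) ^+ 2 + (1 - v) ^+ 2 / 32 * rr z <=
   v * (1 - v) ^+ 2 - (1 - v) * (1 - 3 * v) * v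
   + ((1 - v) * (1 - 3 * v) + (1 - v) ^+ 2 * b / 8) * u z.
  move=> Pz; have /andP[z0 z1] := u01 _ Pz; have r1 := ru _ Pz; have r2 := rb _ Pz.
  set U := u z in z0 z1 r1 r2 *; set r := rr z in r1 r2 *.
  (* If [U <= 1/2], the last hypothesis gives [r <= 4 b U]. Otherwise the remainder of the tangent
     expansion is at least [1/16 * 1/2], and [r <= 1] is at most 32 times that; this is the origin
     of 32. *)
  have key : r <= 4 * b * U + 32 * ((U - v) ^+ 2 * (2 - 2 * v - U)).
    have c0 : 0 <= (U - v) ^+ 2 * (2 - 2 * v - U).
      by rewrite mulr_ge0 ?sqr_ge0 //; lra.
    have bU : 0 <= b * U by apply: mulr_ge0.
    case: (lerP U 2^-1) => hU.
      case: (lerP r 0) => hr; first lra.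
      have : r * 2^-1 <= r * (1 - U) by rewrite ler_pM2l //; lra.
      lra.
    have d1 : 4^-1 <= U - v by lra.
    have d2 : 16^-1 <= (U - v) ^+ 2 by nra.
    have d3 : 2^-1 <= 2 - 2 * v - U by lra.
    have : 16^-1 * 2^-1 <= (U - v) ^+ 2 * (2 - 2 * v - U) by apply: ler_pM => //; lra.
    lra.
  have w1 : 0 <= (1 - v) ^+ 2 by exact: sqr_ge0.
  have w2 : (1 - v) ^+ 2 <= 1 by nra.
  have c0 : 0 <= (U - v) ^+ 2 * (2 - 2 * v - U).
    by rewrite mulr_ge0 ?sqr_ge0 //; lra.
  have : (1 - v) ^+ 2 * ((U - v) ^+ 2 * (2 - 2 * v - U)) <= (U - v) ^+ 2 * (2 - 2 * v - U).
    exact: ler_piMl.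
  have : (1 - v) ^+ 2 * r <= (1 - v) ^+ 2 * (4 * b * U + 32 * ((U - v) ^+ 2 * (2 - 2 * v - U))).
    by apply: ler_wpM2l.
  have -> : U * (1 - U) ^+ 2 = v * (1 - v) ^+ 2 + (1 - v) * (1 - 3 * v) * (U - v)
     - (U - v) ^+ 2 * (2 - 2 * v - U) by ring.
  move: ((U - v) ^+ 2 * (2 - 2 * v - U)) => C; nra.
have := ler_sum (index_enum I) pt; rewrite !big_split /= !cst -mulrDr -!mulr_sumr -/s.
move: (\sum_(z | P z) u z * (1 - u z) ^+ 2) (\sum_(z | P z) rr z) => A B h.
rewrite mulrDr addrA addrAC.
apply: (le_trans (lerD h (lexx _))).
have -> : (m%:R - 1) * (v * (1 - v) ^+ 2 - (1 - v) * (1 - 3 * v) * v) =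
   (1 - v) * ((1 - v) ^+ 2 - (1 - v) * (1 - 3 * v)) by transitivity ((m%:R * v - v) * ((1 - v) ^+ 2 - (1 - v) * (1 - 3 * v))); [ring|rewrite mv].
have sb : ((1 - v) * (1 - 3 * v)) * s <= ((1 - v) * (1 - 3 * v)) * (1 - b).
  by apply: ler_wpM2l; [apply: mulr_ge0; lra|lra].
have s1 : b * s <= b by rewrite ler_piMr //; lra.
have s2 : (1 - v) ^+ 2 * (b * s) <= (1 - v) ^+ 2 * b by apply: ler_wpM2l => //; exact: sqr_ge0.
(* This is exactly what remains of the right-hand side once [sb] and [s1] are used; 5/32 is 1/8 from
   [pt] plus 1/32 from the term in [b] of the statement. *)
have fin : 0 <= (1 - v) * (2 * v ^+ 2 + b * ((1 - 3 * v) - 5 / 32 * (1 - v))).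
  apply: mulr_ge0; first lra.
  apply: addr_ge0; first by rewrite mulr_ge0 ?sqr_ge0.
  by apply: mulr_ge0 => //; lra.
nra.
Qed.

(** One step of the induction for a fixed [zeta], with [a z = zeta z + 1]; these sum to [T - 1]
    because [zeta] lacks one particle. The first sum is the bound inherited after revealing [z], the
    second the cost of the revelation. Comparing the coefficients of each [w x] reduces the claim to
    [size_biased_slack]. *)
Lemma size_biased_weights (F : realFieldType) (V : finType) (S : {set V})
    (a w : V -> F) (T : F) :
  (2 <= #|S|)%N -> (forall z, z \in S -> 1 <= a z) ->
  T = 1 + \sum_(z in S) a z -> (forall z, 0 <= w z) ->
  \sum_(z in S) a z * (1280 * ((T - a z) / (#|S|%:R - 1)) ^+ 2
                        * \sum_(x in S | x != z) w x)
  + 20 * (T / #|S|%:R) ^+ 2 * \sum_(z in S) a z * \sum_(y in S | y != z)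
       a y / (T - 1 - a z) * (2 * (w z + w y))
  <= T * (1280 * (T / #|S|%:R) ^+ 2 * \sum_(x in S) w x).
Proof.
move=> S2 a1 TE w0; set m : F := #|S|%:R.
have m2 : 2 <= m by rewrite (ler_nat _ 2).
have a0 z : z \in S -> 0 <= a z by move/a1; apply: le_trans.
have Tz z : z \in S -> T - 1 - a z = \sum_(y in S | y != z) a y.
  by move=> zS; rewrite TE (bigD1 z zS) /=; ring.
have Tx x z : x \in S -> z \in S -> x != z -> a x <= T - 1 - a z.
  move=> xS zS xz; rewrite Tz // (bigD1 x) /=; last by rewrite xS.
  by rewrite lerDl; apply: sumr_ge0 => y /andP[/andP[/a0]].
have T0 : 1 <= T by rewrite TE lerDl; apply: sumr_ge0 => z /a0.
have Tz0 z : z \in S -> 1 <= T - 1 - a z.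
  move=> zS; have : (0 < #|S :\ z|)%N.
    by move: S2; rewrite (cardsD1 z) zS.
  case/card_gt0P => x; rewrite !inE => /andP[xz xS].
  by apply: le_trans (a1 _ xS) (Tx _ _ xS zS xz).
pose coef x := 1280 * (\sum_(z in S | z != x) a z * ((T - a z) / (m - 1)) ^+ 2)
   + 40 * (T / m) ^+ 2 * (a x + \sum_(z in S | z != x) a z * a x / (T - 1 - a z)).
have exch (G : V -> V -> F) : \sum_(z in S) \sum_(x in S | x != z) G z x =
    \sum_(x in S) \sum_(z in S | z != x) G z x.
  rewrite (exchange_big_dep (mem S)) /=; last by move=> ? ? _ /andP[].
  by apply: eq_bigr => x xS; apply: eq_bigl => z; rewrite xS eq_sym.
have -> : \sum_(z in S) a z * (1280 * ((T - a z) / (m - 1)) ^+ 2 * \sum_(x in S | x != z) w x)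
  + 20 * (T / m) ^+ 2 * (\sum_(z in S) a z * \sum_(y in S | y != z)
       a y / (T - 1 - a z) * (2 * (w z + w y))) = \sum_(x in S) w x * coef x.
  have -> : \sum_(z in S) a z * (1280 * ((T - a z) / (m - 1)) ^+ 2 * \sum_(x in S | x != z) w x)
     = \sum_(x in S) w x * (1280 * (\sum_(z in S | z != x) a z * ((T - a z) / (m - 1)) ^+ 2)).
    under eq_bigr do rewrite !mulr_sumr.
    rewrite exch; apply: eq_bigr => x _; rewrite !mulr_sumr; apply: eq_bigr => z _; ring.
  have -> : \sum_(z in S) a z * (\sum_(y in S | y != z) a y / (T - 1 - a z) * (2 * (w z + w y)))
    = \sum_(x in S) w x * (2 * (a x + \sum_(z in S | z != x) a z * a x / (T - 1 - a z))).
    transitivity (\sum_(z in S) (2 * w z * a z) +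
       \sum_(z in S) \sum_(y in S | y != z) 2 * w y * (a z * a y / (T - 1 - a z))).
      rewrite -big_split /=; apply: eq_bigr => z zS.
      have -> : 2 * w z * a z = \sum_(y in S | y != z) 2 * w z * a z / (T - 1 - a z) * a y.
        rewrite -mulr_sumr -Tz // mulfVK // gt_eqF //.
        by apply: lt_le_trans (Tz0 _ zS).
      by rewrite -big_split mulr_sumr /=; apply: eq_bigr => y _; ring.
    rewrite exch -big_split /=; apply: eq_bigr => x _.
    by rewrite -mulr_sumr; ring.
  rewrite mulr_sumr -big_split /=; apply: eq_bigr => x _.
  by rewrite /coef; ring.
rewrite !mulr_sumr; apply: ler_sum => x xS.
suff cl : coef x <= T * (1280 * (T / m) ^+ 2).
  rewrite [X in X <= _]mulrC [X in _ <= X]mulrA; exact: ler_wpM2r.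
have Tn : T != 0 by rewrite gt_eqF //; apply: lt_le_trans T0.
have mn : m != 0 by rewrite gt_eqF //; lra.
have m1n : m - 1 != 0 by rewrite gt_eqF //; lra.
have Tp : 0 < T by apply: lt_le_trans T0.
(* Here [x] is the site whose coefficient is estimated and [z] the revealed one. The hypotheses hold
   because [a x <= T - 1 - a z] and [T - a z <= 2 (T - 1 - a z)], the latter since another site
   remains. *)
have := @size_biased_slack F V (fun z => (z \in S) && (z != x)) (fun z => a z / T)
  (fun z => a z * a x / (T - 1 - a z) / T) (a x / T) #|S| S2.
rewrite -/m => H.
have {}H : \sum_(z in S | z != x) a z / T * (1 - a z / T) ^+ 2
   + ((m - 1) / m) ^+ 2 / 32 * (a x / T + \sum_(z in S | z != x) a z * a x / (T - 1 - a z) / T)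
   <= ((m - 1) / m) ^+ 2.
  apply: H.
  - by rewrite (cardsD1 x S) xS add1n /=; apply: eq_card => z; rewrite !inE andbC.
  - move=> z /andP[zS _]; rewrite divr_ge0 ?a0 ?(ltW Tp) //= ler_pdivrMr // mul1r.
    by have := Tz0 _ zS; lra.
  - by rewrite divr_ge0 ?a0 // ltW.
  - rewrite -mulr_suml -Tz // -mulrDl ler_pdivrMr //; lra.
  - move=> z /andP[zS zx]; rewrite ler_pM2r ?invr_gt0 // ler_pdivrMr.
      by rewrite ler_wpM2l ?a0 // Tx // eq_sym.
    by apply: lt_le_trans (Tz0 _ zS).
  move=> z /andP[zS zx]; have t1 := Tz0 _ zS; have t0 : 0 < T - 1 - a z by apply: lt_le_trans t1.
  have -> : a z * a x / (T - 1 - a z) / T * (1 - a z / T) =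
     (a z * a x / (T ^+ 2)) * ((T - a z) / (T - 1 - a z)).
    by field; rewrite Tn gt_eqF.
  have -> : 2 * (a x / T) * (a z / T) = (a z * a x / (T ^+ 2)) * 2 by field.
  apply: ler_wpM2l; first by apply: divr_ge0; rewrite ?sqr_ge0 //; apply: mulr_ge0; apply: a0.
  by rewrite ler_pdivrMr //; lra.
have e1 : \sum_(z in S | z != x) a z * ((T - a z) / (m - 1)) ^+ 2 =
   T ^+ 3 / (m - 1) ^+ 2 * \sum_(z in S | z != x) a z / T * (1 - a z / T) ^+ 2.
  rewrite mulr_sumr; apply: eq_bigr => z _; field.
  by rewrite Tn m1n.
have e2 : a x + \sum_(z in S | z != x) a z * a x / (T - 1 - a z) =
   T * (a x / T + \sum_(z in S | z != x) a z * a x / (T - 1 - a z) / T).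
  rewrite mulrDr -mulr_suml; field; exact: Tn.
rewrite /coef e1 e2.
move: (\sum_(z in S | z != x) a z / T * (1 - a z / T) ^+ 2) H => A.
move: (a x / T + _) => B H.
have c0 : 0 <= 1280 * T ^+ 3 / (m - 1) ^+ 2.
  by apply: divr_ge0; rewrite ?sqr_ge0 ?mulr_ge0 ?exprn_ge0 // ltW.
(* The gain 1/32 times 1280 is 40, twice the constant 20 of the one-site inequality: this fixes
   1280. *)
have := ler_wpM2l c0 H.
have -> : 1280 * T ^+ 3 / (m - 1) ^+ 2 * (A + ((m - 1) / m) ^+ 2 / 32 * B)
  = 1280 * (T ^+ 3 / (m - 1) ^+ 2 * A) + 40 * (T / m) ^+ 2 * (T * B).
  by field; rewrite mn m1n.
have -> : 1280 * T ^+ 3 / (m - 1) ^+ 2 * ((m - 1) / m) ^+ 2 = T * (1280 * (T / m) ^+ 2).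
  by field; rewrite mn m1n.
by [].
Qed.

(** * Configurations frozen outside a set of sites *)

(* [inord] sends an overflowing value to 0, so this adds a particle only when [eta x < N]. *)
Definition add_particle (V : finType) N (eta : {ffun V -> 'I_N.+1}) (x : V)
  : {ffun V -> 'I_N.+1} := [ffun z => inord (eta z + (z == x))%N].

Definition del_particle (V : finType) N (eta : {ffun V -> 'I_N.+1}) (x : V)
  : {ffun V -> 'I_N.+1} := [ffun z => inord (eta z - (z == x))%N].

Definition fiber (V : finType) N (S : {set V}) (w : {ffun V -> 'I_N.+1}) (t : nat)
  : {set {ffun V -> 'I_N.+1}} :=
  [set eta : {ffun V -> 'I_N.+1} | (\sum_x (eta x : nat) == t)%N && [forall z in ~: S, eta z == w z]].

Lemma fiberP (V : finType) N (S : {set V}) (w eta : {ffun V -> 'I_N.+1}) t :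
  reflect ((\sum_x (eta x : nat))%N = t /\ forall z, z \notin S -> eta z = w z)
    (eta \in fiber S w t).
Proof.
rewrite inE; apply: (iffP andP) => [[/eqP e /forall_inP h]|[e h]]; split => //.
- by move=> z zS; apply/eqP/h; rewrite inE.
- exact/eqP.
- by apply/forall_inP => z; rewrite inE => /h ->.
Qed.

Lemma occupation_le (V : finType) N (eta : {ffun V -> 'I_N.+1}) x :
  (eta x <= \sum_z (eta z : nat))%N.
Proof. by rewrite (bigD1 x) //= leq_addr. Qed.

Lemma add_particleE (V : finType) N (eta : {ffun V -> 'I_N.+1}) x z :
  (\sum_y (eta y : nat) < N)%N -> (add_particle eta x z = eta z + (z == x) :> nat)%N.
Proof.
move=> lt; rewrite ffunE inordK //.
by have := occupation_le eta z; case: (z == x) => /=; lia.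
Qed.

Lemma del_particleE (V : finType) N (eta : {ffun V -> 'I_N.+1}) x z :
  (del_particle eta x z = eta z - (z == x) :> nat)%N.
Proof. by rewrite ffunE inordK // (leq_ltn_trans (leq_subr _ _)). Qed.

Lemma sum_add_particle (V : finType) N (eta : {ffun V -> 'I_N.+1}) x :
  (\sum_y (eta y : nat) < N)%N ->
  (\sum_y (add_particle eta x y : nat))%N = (\sum_y (eta y : nat)).+1.
Proof.
move=> lt; under eq_bigr do rewrite add_particleE //.
rewrite big_split /= -[RHS]addn1; congr addn.
by rewrite (bigD1 x) //= eqxx big1 ?addn0 // => z /negPf ->.
Qed.

Lemma add_particleK (V : finType) N (eta : {ffun V -> 'I_N.+1}) x :
  (\sum_y (eta y : nat) < N)%N -> del_particle (add_particle eta x) x = eta.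
Proof.
by move=> lt; apply/ffunP => z; apply: val_inj; rewrite /= del_particleE add_particleE // addnK.
Qed.

Lemma del_particleK (V : finType) N (eta : {ffun V -> 'I_N.+1}) x :
  (0 < eta x)%N -> add_particle (del_particle eta x) x = eta.
Proof.
move=> pos; apply/ffunP => z; apply: val_inj; rewrite ffunE /= del_particleE subnK ?inord_val //.
by case: eqP => [->|].
Qed.

Lemma sum_del_particle (V : finType) N (eta : {ffun V -> 'I_N.+1}) x :
  (0 < eta x)%N ->
  (\sum_y (eta y : nat))%N = (\sum_y (del_particle eta x y : nat)).+1.
Proof.
move=> pos; rewrite (bigD1 x) //= [in RHS](bigD1 x) //= del_particleE eqxx.
rewrite -addSn subn1 prednK //; congr addn.
by apply: eq_bigr => z /negPf zx; rewrite del_particleE zx subn0.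
Qed.

(* The correspondence between [eta] with [eta y > 0] and [zeta = eta - delta_y]. *)
Lemma sum_fiber_shift (F : realFieldType) (V : finType) N (S : {set V})
    (w : {ffun V -> 'I_N.+1}) t y (G : {ffun V -> 'I_N.+1} -> F) :
  (t < N)%N -> y \in S ->
  \sum_(eta in fiber S w t.+1 | (0 < eta y)%N) G eta =
  \sum_(zeta in fiber S w t) G (add_particle zeta y).
Proof.
move=> tN yS.
rewrite (reindex_onto ((@add_particle V N)^~ y) ((@del_particle V N)^~ y)) /=; last first.
  by move=> eta /andP[_]; exact: del_particleK.
apply: eq_bigl => zeta; apply/andP/idP => [[/andP[/fiberP[sm off] pos] /eqP e]|].
  apply/fiberP; split; first by move: sm; rewrite (sum_del_particle pos) e => -[].
  move=> z zS; rewrite -off //.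
  have zy : (z == y) = false by apply: contraNF zS => /eqP ->.
  by apply: val_inj; rewrite ffunE zy addn0 /= inord_val.
move=> /fiberP[sm off]; have lt : (\sum_x (zeta x : nat) < N)%N by rewrite sm.
split; last by rewrite add_particleK.
apply/andP; split; last by rewrite add_particleE // eqxx addn1.
apply/fiberP; split; first by rewrite sum_add_particle // sm.
move=> z zS; rewrite -off //.
have zy : (z == y) = false by apply: contraNF zS => /eqP ->.
by apply: val_inj; rewrite /= add_particleE // zy addn0.
Qed.

Definition set_site (V : finType) N (w : {ffun V -> 'I_N.+1}) (z : V) (k : 'I_N.+1)
  : {ffun V -> 'I_N.+1} := [ffun y => if y == z then k else w y].

(** Conditioning on the number of particles at [z] yields again a fiber, with one free site fewer;
    the induction on [S] rests on this. *)
Lemma fiberD1 (V : finType) N (S : {set V}) (w eta : {ffun V -> 'I_N.+1}) t z k :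
  z \in S ->
  (eta \in fiber (S :\ z) (set_site w z k) t) = (eta \in fiber S w t) && (eta z == k).
Proof.
move=> zS; apply/fiberP/andP => [[sm off]|[/fiberP[sm off] /eqP ek]].
  split; last by rewrite off ?inE ?eqxx // ffunE eqxx.
  apply/fiberP; split => // y yS; rewrite off ?inE ?(negPf yS) ?andbF // ffunE.
  by case: eqP => // yz; rewrite -yz (negPf yS) in zS.
split=> // y; rewrite !inE negb_and negbK ffunE; case: eqP => [-> _ // | _ /=].
exact: off.
Qed.

Lemma sum_fiber_inside (F : realFieldType) (V : finType) N (S : {set V})
    (w eta : {ffun V -> 'I_N.+1}) t :
  eta \in fiber S w t ->
  \sum_(z in S) (eta z)%:R = t%:R - (\sum_(z in ~: S) (w z : nat))%:R :> F.
Proof.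
move=> /fiberP[<- off]; rewrite [X in X%:R - _](bigID (mem S)) /= natrD natr_sum.
rewrite [X in _ + X%:R](_ : _ = (\sum_(z in ~: S) (w z : nat))%N); first by rewrite addrK.
by apply: eq_big => z; [rewrite inE|move=> zS; rewrite off].
Qed.

(** * Conditioning on the occupation number of one site *)

Lemma sum_fiber_partition (F : realFieldType) (V : finType) N (A : {set {ffun V -> 'I_N.+1}})
    z (G : {ffun V -> 'I_N.+1} -> F) :
  \sum_(eta in A) G eta = \sum_(k < N.+1) \sum_(eta in A | eta z == k) G eta.
Proof. exact: (partition_big (fun eta : {ffun V -> 'I_N.+1} => eta z) predT). Qed.

Lemma sum_fiber_site_succ (F : realFieldType) (V : finType) N (S : {set V})
    (w : {ffun V -> 'I_N.+1}) t z k (G : {ffun V -> 'I_N.+1} -> F) :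
  (t < N)%N -> z \in S ->
  \sum_(eta in fiber S w t.+1 | eta z == k.+1 :> nat) G eta =
  \sum_(zeta in fiber S w t | zeta z == k :> nat) G (add_particle zeta z).
Proof.
move=> tN zS.
pose G' (eta : {ffun V -> 'I_N.+1}) := if (eta z == k.+1 :> nat) then G eta else 0.
transitivity (\sum_(eta in fiber S w t.+1 | (0 < eta z)%N) G' eta).
  rewrite [RHS]big_mkcondr [LHS]big_mkcondr.
  by apply: eq_bigr => eta _; rewrite /G'; case: (eta z : nat) => // n; case: eqP.
rewrite sum_fiber_shift // [RHS]big_mkcondr; apply: eq_bigr => zeta /fiberP[sm _].
by rewrite /G' add_particleE ?sm // eqxx addn1 eqSS.
Qed.

(** The scalar on the left counts the particles of [S] away from [z]. Summing over them and deleting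
    the chosen one turns [eta y] into [zeta y + 1]. For constant [G] this is the recursion of
    [site_count]; for a general one it describes level [k] as [zeta] plus a particle at a random
    [y]. *)
Lemma sum_fiber_site_mean (F : realFieldType) (V : finType) N (S : {set V})
    (w : {ffun V -> 'I_N.+1}) t z k (G : {ffun V -> 'I_N.+1} -> F) :
  (t < N)%N -> z \in S ->
  (t.+1%:R - (\sum_(y in ~: S) (w y : nat))%:R - k%:R) *
    (\sum_(eta in fiber S w t.+1 | eta z == k :> nat) G eta) =
  \sum_(zeta in fiber S w t | zeta z == k :> nat)
    \sum_(y in S | y != z) ((zeta y)%:R + 1) * G (add_particle zeta y).
Proof.
move=> tN zS; rewrite mulr_sumr.
transitivity (\sum_(eta in fiber S w t.+1 | eta z == k :> nat)
    \sum_(y in S | y != z) (eta y)%:R * G eta).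
  apply: eq_bigr => eta /andP[/(sum_fiber_inside F) <- /eqP <-].
  by rewrite (bigD1 z zS) /= addrAC subrr add0r mulr_suml.
rewrite exchange_big [RHS]exchange_big /=; apply: eq_bigr => y /andP[yS yz].
pose G' (eta : {ffun V -> 'I_N.+1}) := if (eta z == k :> nat) then (eta y)%:R * G eta else 0.
transitivity (\sum_(eta in fiber S w t.+1 | (0 < eta y)%N) G' eta).
  rewrite [RHS]big_mkcondr [LHS]big_mkcondr.
  apply: eq_bigr => eta _; rewrite /G'; case: eqP => _; last by case: ifP.
  by case: (eta y : nat) => //; rewrite mul0r.
rewrite sum_fiber_shift // [RHS]big_mkcondr; apply: eq_bigr => zeta /fiberP[sm _].
have zy : (z == y) = false by rewrite eq_sym; apply: negbTE.
by rewrite /G' !add_particleE ?sm // eqxx zy addn0 addn1 natr1.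
Qed.

Definition site_count (F : realFieldType) (V : finType) N (S : {set V})
    (w : {ffun V -> 'I_N.+1}) t z k : F :=
  \sum_(eta in fiber S w t | eta z == k :> nat) 1.

Definition site_mean (F : realFieldType) (V : finType) N (S : {set V})
    (w : {ffun V -> 'I_N.+1}) t z (f : {ffun V -> 'I_N.+1} -> F) k : F :=
  (\sum_(eta in fiber S w t | eta z == k :> nat) f eta) / site_count F S w t z k.

(** When no configuration has [k] particles at [z], both sides vanish, so the division by zero in
    [site_mean] does no harm. *)
Lemma site_meanE (F : realFieldType) (V : finType) N (S : {set V})
    (w : {ffun V -> 'I_N.+1}) t z (f : {ffun V -> 'I_N.+1} -> F) k :
  site_count F S w t z k * site_mean S w t z f k =
  \sum_(eta in fiber S w t | eta z == k :> nat) f eta.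
Proof.
case: (eqVneq (site_count F S w t z k) 0) => [pk|pn]; last first.
  by rewrite /site_mean mulrC mulfVK.
rewrite pk mul0r big_pred0 // => eta.
apply/negP => H; have : 1 <= site_count F S w t z k.
  by rewrite /site_count (bigD1 eta) //= lerDl sumr_ge0.
by rewrite pk; lra.
Qed.

(** A coupling: levels [k + 1] and [k] both arise from the same [zeta] with [k] particles at [z], by
    adding a particle at [z] or at some [y] drawn with weight [zeta y + 1]. The increment of the
    conditional mean is thus an average of differences of [f], and Jensen's inequality feeds it into
    the weighted one-dimensional inequality. *)
Lemma site_variance (F : realFieldType) (V : finType) q (S : {set V})
    (w : {ffun V -> 'I_q.+2}) s z (f : {ffun V -> 'I_q.+2} -> F) mu :
  (2 <= #|S|)%N -> z \in S ->
  (\sum_(y in ~: S) (w y : nat) + s = q.+1)%N ->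
  \sum_(eta in fiber S w q.+1) (f eta - mu) = 0 ->
  \sum_(k < q.+2) k.+1%:R *
    (site_count F S w q.+1 z k * (site_mean S w q.+1 z f k - mu) ^+ 2) <=
  20 * ((s%:R + #|S|%:R) / #|S|%:R) ^+ 2 *
   \sum_(zeta in fiber S w q) ((zeta z)%:R + 1) *
     \sum_(y in S | y != z) ((zeta y)%:R + 1) / (s%:R + #|S|%:R - 1 - ((zeta z)%:R + 1))
       * (f (add_particle zeta z) - f (add_particle zeta y)) ^+ 2.
Proof.
move=> S2 zS ws cen.
set p := site_count F S w q.+1 z; set av := site_mean S w q.+1 z f; set m : F := #|S|%:R.
have m2 : 2 <= m by rewrite (ler_nat _ 2).
have sE : q.+1%:R - (\sum_(y in ~: S) (w y : nat))%:R = s%:R :> F.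
  by move: (congr1 (fun n : nat => n%:R : F) ws); rewrite natrD; lra.
have sle : (s <= q.+1)%N by rewrite -ws leq_addl.
have p0 k : 0 <= p k by apply: sumr_ge0.
have inS eta : eta \in fiber S w q.+1 -> \sum_(y in S) (eta y)%:R = s%:R :> F.
  by move/(sum_fiber_inside F) => ->.
have inS' zeta : zeta \in fiber S w q -> \sum_(y in S | y != z) ((zeta y)%:R + 1) = s%:R - (zeta z)%:R + m - 2 :> F.
  move/(sum_fiber_inside F); rewrite (bigD1 z zS) /= big_split /= => e.
  have -> : \sum_(y in S | y != z) (1 : F) = m - 1.
    by have := sumr_const (mem S) (1 : F); rewrite (bigD1 z zS) -/m /=; lra.
  have {}e : \sum_(y in S | y != z) (zeta y)%:R = s%:R - 1 - (zeta z)%:R :> F.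
    by move: e sE; rewrite -[q.+1%:R]natr1; lra.
  by rewrite e; ring.
have ps k : s%:R < k%:R :> F -> p k = 0.
  rewrite ltr_nat => sk; apply: big_pred0 => eta.
  apply/negP => /andP[/inS + /eqP ek]; rewrite -natr_sum => /eqP; rewrite eqr_nat (bigD1 z zS) /= ek.
  by move/eqP; lia.
have cnt k : \sum_(zeta in fiber S w q | zeta z == k :> nat) (1 : F) = p k.+1.
  by rewrite /p /site_count sum_fiber_site_succ.
have prec k : p k * (s%:R - k%:R) = p k.+1 * (s%:R - k%:R + m - 2).
  rewrite mulrC -sE (sum_fiber_site_mean w k (fun=> 1)) // -cnt mulr_suml sE.
  apply: eq_bigr => zeta /andP[zf /eqP zk]; under eq_bigr do rewrite mulr1.
  by rewrite mul1r (inS' _ zf) zk.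
have avE k : p k * av k = \sum_(eta in fiber S w q.+1 | eta z == k :> nat) f eta.
  exact: site_meanE.
have cen' : \sum_(k < q.+2) p k * (av k - mu) = 0.
  rewrite -[RHS]cen (sum_fiber_partition _ z); apply: eq_bigr => k _.
  rewrite mulrBr avE sumrB; congr (_ - _).
  by rewrite /p /site_count mulr_suml; apply: eq_bigr => eta _; rewrite mul1r.
have s2 : s%:R < q.+2%:R :> F by rewrite ltr_nat.
have grad k : p k.+1 * (av k.+1 - av k) ^+ 2 <=
   \sum_(zeta in fiber S w q | zeta z == k :> nat)
     \sum_(y in S | y != z) ((zeta y)%:R + 1) / (s%:R - k%:R + m - 2)
       * (f (add_particle zeta z) - f (add_particle zeta y)) ^+ 2.
  have a0 (zeta : {ffun V -> 'I_q.+2}) y : 0 <= (zeta y)%:R + 1 :> F by rewrite addr_ge0.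
  have term0 (zeta : {ffun V -> 'I_q.+2}) y (d : F) : zeta \in fiber S w q -> zeta z = k :> nat ->
     0 <= ((zeta y)%:R + 1) / (s%:R - k%:R + m - 2) * d ^+ 2.
    move=> zf zk; rewrite mulr_ge0 ?sqr_ge0 // divr_ge0 // -zk -inS' //.
    by apply: sumr_ge0.
  (* If level [k + 1] is empty the denominator may fail to be positive. Otherwise some [zeta]
     exists, and a second site of [S] makes it positive. *)
  case: (eqVneq (p k.+1) 0) => [->|pn].
    rewrite mul0r; apply: sumr_ge0 => zeta /andP[zf /eqP zk]; apply: sumr_ge0 => y _.
    exact: term0.
  set B := s%:R - k%:R + m - 2 in term0 *.
  have B0 : 0 < B.
    have [zeta /andP[zf /eqP zk]] : exists zeta, (zeta \in fiber S w q) && (zeta z == k :> nat).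
      apply/existsP; apply: contra_neqT pn => /existsPn h.
      by rewrite -cnt big_pred0 // => zeta; exact/negbTE/h.
    rewrite /B -zk -inS' //.
    have : (0 < #|S :\ z|)%N by move: S2; rewrite (cardsD1 z) zS.
    case/card_gt0P => y; rewrite !inE => /andP[yz yS].
    rewrite (bigD1 y) /=; last by rewrite yS.
    by rewrite ltr_wpDr ?sumr_ge0 // ltr_wpDl.
  set d := av k.+1 - av k.
  have mean : \sum_(zeta in fiber S w q | zeta z == k :> nat)
     \sum_(y in S | y != z) ((zeta y)%:R + 1) / B
       * (f (add_particle zeta z) - f (add_particle zeta y)) = p k.+1 * d.
    transitivity (\sum_(zeta in fiber S w q | zeta z == k :> nat)
      (f (add_particle zeta z)
        - B^-1 * \sum_(y in S | y != z) ((zeta y)%:R + 1) * f (add_particle zeta y))).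
      apply: eq_bigr => zeta /andP[zf /eqP zk].
      have e : f (add_particle zeta z) =
          \sum_(y in S | y != z) ((zeta y)%:R + 1) / B * f (add_particle zeta z).
        by rewrite -mulr_suml -mulr_suml inS' // zk divff ?mul1r // gt_eqF.
      by rewrite [X in _ = X - _]e mulr_sumr -sumrB; apply: eq_bigr => y _; ring.
    rewrite sumrB -mulr_sumr -(sum_fiber_site_mean w k) // sE -(sum_fiber_site_succ w k) //.
    rewrite -!avE [(s%:R - _) * _]mulrCA mulrA prec -/B /d; field.
    by rewrite gt_eqF.
  have tot : \sum_(zeta in fiber S w q | zeta z == k :> nat)
     \sum_(y in S | y != z) ((zeta y)%:R + 1) / B = p k.+1.
    rewrite -cnt; apply: eq_bigr => zeta /andP[zf /eqP zk].
    by rewrite -mulr_suml inS' // zk divff // gt_eqF.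
  (* Jensen as an identity: by [mean] and [tot] the difference is the sum of the weighted squared
     deviations from [d]. *)
  rewrite -subr_ge0.
  have -> : (\sum_(zeta in fiber S w q | zeta z == k :> nat)
     \sum_(y in S | y != z) ((zeta y)%:R + 1) / B
       * (f (add_particle zeta z) - f (add_particle zeta y)) ^+ 2) - p k.+1 * d ^+ 2 =
    \sum_(zeta in fiber S w q | zeta z == k :> nat)
     \sum_(y in S | y != z) ((zeta y)%:R + 1) / B
       * (f (add_particle zeta z) - f (add_particle zeta y) - d) ^+ 2.
    transitivity (\sum_(zeta in fiber S w q | zeta z == k :> nat)
     \sum_(y in S | y != z) (((zeta y)%:R + 1) / B
       * (f (add_particle zeta z) - f (add_particle zeta y)) ^+ 2
       - 2 * d * (((zeta y)%:R + 1) / B * (f (add_particle zeta z) - f (add_particle zeta y)))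
       + d ^+ 2 * (((zeta y)%:R + 1) / B))).
      under [RHS]eq_bigr do rewrite big_split sumrB /= -!mulr_sumr.
      by rewrite big_split sumrB /= -!mulr_sumr mean tot; ring.
    by apply: eq_bigr => zeta _; apply: eq_bigr => y _; ring.
  by apply: sumr_ge0 => zeta /andP[zf /eqP zk]; apply: sumr_ge0 => y _; exact: term0.
have := @weighted_birth_death_poincare F p (fun k => av k - mu) s%:R m q.+2
  m2 (ler0n _ _) p0 ps s2 prec cen'.
have -> : \sum_(k < q.+2) p k * k.+1%:R * (av k - mu) ^+ 2 =
    \sum_(k < q.+2) k.+1%:R * (p k * (av k - mu) ^+ 2) by apply: eq_bigr => k _; ring.
move/le_trans; apply; apply: ler_wpM2l; first by rewrite mulr_ge0 ?sqr_ge0.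
rewrite (sum_fiber_partition _ z); apply: ler_sum => k _.
have -> : av k.+1 - mu - (av k - mu) = av k.+1 - av k by ring.
rewrite mulrAC mulrC; apply: le_trans (ler_wpM2l (ler0n _ _) (grad k)) _.
rewrite mulr_sumr; apply: ler_sum => zeta /andP[zf /eqP zk].
rewrite zk natr1; apply: ler_wpM2l => //.
rewrite le_eqVlt; apply/orP; left; apply/eqP; apply: eq_bigr => y _.
by rewrite -natr1; congr (_ / _ * _); ring.
Qed.

(** * Induction on the number of free sites *)

Lemma fiber_small (V : finType) N (S : {set V}) (w : {ffun V -> 'I_N.+1}) t eta xi :
  (#|S| <= 1)%N -> eta \in fiber S w t -> xi \in fiber S w t -> eta = xi.
Proof.
move=> S1 /fiberP[sm off] /fiberP[sm' off'].
have out z : z \notin S -> eta z = xi z by move=> zS; rewrite off // off'.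
apply/ffunP => z; case: (boolP (z \in S)) => [zS|]; last exact: out.
apply: val_inj => /=.
have rest : (\sum_(y | y != z) (eta y : nat) = \sum_(y | y != z) (xi y : nat))%N.
  apply: eq_bigr => y yz; rewrite out //; apply: contraNN yz => yS.
  by rewrite (card_le1_eqP S1 y z).
by move: sm; rewrite -sm' (bigD1 z) //= [in RHS](bigD1 z) //= rest => /addIn.
Qed.

Lemma fiber_small_variance (F : realFieldType) (V : finType) N (S : {set V})
    (w : {ffun V -> 'I_N.+1}) t (f : {ffun V -> 'I_N.+1} -> F) mu :
  (#|S| <= 1)%N -> \sum_(eta in fiber S w t) (f eta - mu) = 0 ->
  \sum_(eta in fiber S w t) (f eta - mu) ^+ 2 = 0.
Proof.
move=> S1 cen; apply: big1 => eta ef.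
have : \sum_(xi in fiber S w t) (f eta - mu) = 0.
  by rewrite -[RHS]cen; apply: eq_bigr => xi xf; rewrite (fiber_small S1 ef xf).
rewrite sumr_const => /eqP; rewrite mulrn_eq0 => /orP[/eqP c0|/eqP ->]; last by rewrite expr0n.
by move: ef; rewrite (card0_eq c0).
Qed.

(** For each [z], the variance weighted by [eta z + 1] is split into a part within the levels of
    [eta z], bounded by induction, and a part between them, bounded by [site_variance]. After
    summation over [z], [size_biased_weights] returns the same constant. The centre [c] is arbitrary
    and stays fixed throughout the induction. *)
Lemma fiber_variance (F : realFieldType) (V : finType) q (S : {set V})
    (w : {ffun V -> 'I_q.+2}) s (f c : {ffun V -> 'I_q.+2} -> F) mu :
  (\sum_(y in ~: S) (w y : nat) + s = q.+1)%N ->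
  \sum_(eta in fiber S w q.+1) (f eta - mu) = 0 ->
  \sum_(eta in fiber S w q.+1) (f eta - mu) ^+ 2 <=
  1280 * ((s%:R + #|S|%:R) / #|S|%:R) ^+ 2 *
    \sum_(zeta in fiber S w q) \sum_(x in S) (f (add_particle zeta x) - c zeta) ^+ 2.
Proof.
have rhs0 (S' : {set V}) w' (h : F) : 0 <= 1280 * h ^+ 2 *
    \sum_(zeta in fiber S' w' q) \sum_(x in S') (f (add_particle zeta x) - c zeta) ^+ 2.
  apply: mulr_ge0; first by rewrite mulr_ge0 ?sqr_ge0.
  by apply: sumr_ge0 => zeta _; apply: sumr_ge0 => x _; exact: sqr_ge0.
move: {2}#|S| (leqnn #|S|) => n; elim: n S w s mu => [|n IH] S w s mu Sn ws cen.
  by rewrite fiber_small_variance //; exact: leq_trans Sn _.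
case: (leqP #|S| 1) => [S1|S2].
  by rewrite fiber_small_variance.
set m : F := #|S|%:R; set T := s%:R + m.
have m2 : 2 <= m by rewrite (ler_nat _ 2).
have T0 : 0 < T by rewrite /T ltr_wpDl //; lra.
have sE : q.+1%:R - (\sum_(y in ~: S) (w y : nat))%:R = s%:R :> F.
  by move: (congr1 (fun n : nat => n%:R : F) ws); rewrite natrD; lra.
pose W (zeta : {ffun V -> 'I_q.+2}) x := (f (add_particle zeta x) - c zeta) ^+ 2.
have W0 zeta x : 0 <= W zeta x by exact: sqr_ge0.
pose a (zeta : {ffun V -> 'I_q.+2}) x : F := (zeta x)%:R + 1.
have site z : z \in S ->
  \sum_(eta in fiber S w q.+1) ((eta z)%:R + 1) * (f eta - mu) ^+ 2 <=
  \sum_(zeta in fiber S w q) (a zeta z * (1280 * ((T - a zeta z) / (m - 1)) ^+ 2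
                        * \sum_(x in S | x != z) W zeta x)
   + 20 * (T / m) ^+ 2 * (a zeta z * \sum_(y in S | y != z)
       a zeta y / (T - 1 - a zeta z) * (2 * (W zeta z + W zeta y)))).
  move=> zS.
  (* Freezing [z] at [k] leaves one site fewer and [s - k] free particles; for [k > s] the level is
     empty. *)
  have within (k : 'I_q.+2) :
    \sum_(eta in fiber S w q.+1 | eta z == k) (f eta - site_mean S w q.+1 z f k) ^+ 2
    <= 1280 * ((T - k.+1%:R) / (m - 1)) ^+ 2 *
       \sum_(zeta in fiber S w q | zeta z == k) \sum_(x in S | x != z) W zeta x.
    have cS : #|S| = #|S :\ z|.+1 by rewrite (cardsD1 z) zS.
    under eq_bigl do rewrite -fiberD1 //.
    under [X in _ <= _ * X]eq_bigl do rewrite -fiberD1 //.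
    case: (leqP k s) => [ks|sk]; last first.
      rewrite big_pred0; last first.
        move=> eta; apply/negbTE/negP; rewrite fiberD1 // => /andP[/(sum_fiber_inside F)].
        rewrite sE -natr_sum => /eqP; rewrite eqr_nat (bigD1 z zS) /= => /eqP e /eqP ek.
        by move: e; rewrite ek; lia.
      apply: mulr_ge0; first by rewrite mulr_ge0 ?sqr_ge0.
      by apply: sumr_ge0 => zeta _; apply: sumr_ge0.
    have -> : T - k.+1%:R = (s - k)%N%:R + #|S :\ z|%:R.
      by rewrite /T /m cS natrB // -[k.+1%:R]natr1 -[_.+1%:R]natr1; ring.
    have -> : m - 1 = #|S :\ z|%:R by rewrite /m cS -natr1 addrK.
    have xE (zeta : {ffun V -> 'I_q.+2}) : \sum_(x in S | x != z) W zeta x =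
        \sum_(x in S :\ z) (f (add_particle zeta x) - c zeta) ^+ 2.
      by apply: eq_bigl => x; rewrite !inE andbC.
    under [X in _ <= _ * X]eq_bigr do rewrite xE.
    apply: IH.
    - by rewrite -ltnS -cS.
    - rewrite (bigD1 z) /=; last by rewrite !inE eqxx.
      rewrite ffunE eqxx; apply: etrans ws.
      rewrite (eq_big (fun y => y \in ~: S) (fun y => w y : nat)).
      + by lia.
      + move=> y; rewrite !inE negb_and negbK; case: eqP => [->|_]; rewrite ?zS ?andbT ?andbF //.
      + by move=> y /andP[_ /negPf yz]; rewrite ffunE yz.
    - under eq_bigl do rewrite fiberD1 //.
      rewrite sumrB -site_meanE /site_count mulr_suml -sumrB.
      by apply: big1 => eta _; rewrite mul1r subrr.
  (* The law of total variance on the level [k], where the weight is the constant [k + 1]. *)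
  have decomp (k : 'I_q.+2) :
    \sum_(eta in fiber S w q.+1 | eta z == k) ((eta z)%:R + 1) * (f eta - mu) ^+ 2 =
    k.+1%:R * (\sum_(eta in fiber S w q.+1 | eta z == k) (f eta - site_mean S w q.+1 z f k) ^+ 2)
    + k.+1%:R * (site_count F S w q.+1 z k * (site_mean S w q.+1 z f k - mu) ^+ 2).
    rewrite -mulrDr; set M := site_mean _ _ _ _ _ _.
    have cM : \sum_(eta in fiber S w q.+1 | eta z == k) (f eta - M) = 0.
      rewrite sumrB -site_meanE /site_count mulr_suml -sumrB.
      by apply: big1 => eta _; rewrite mul1r subrr.
    transitivity (k.+1%:R * \sum_(eta in fiber S w q.+1 | eta z == k)
       ((f eta - M) ^+ 2 + (2 * (M - mu) * (f eta - M) + 1 * (M - mu) ^+ 2))).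
      rewrite mulr_sumr; apply: eq_bigr => eta /andP[_ /eqP ->].
      by rewrite -natr1; ring.
    by rewrite !big_split /= -mulr_suml -mulr_sumr cM mulr0 add0r.
  rewrite (sum_fiber_partition _ z); under eq_bigr do rewrite decomp.
  rewrite !big_split /=; apply: lerD.
    rewrite (sum_fiber_partition _ z); apply: ler_sum => k _.
    apply: le_trans (ler_wpM2l (ler0n _ _) (within k)) _.
    rewrite !mulr_sumr; apply: ler_sum => zeta /andP[_ /eqP zk].
    by rewrite /a zk natr1 mulrA.
  apply: le_trans (site_variance S2 zS ws cen) _.
  rewrite -/m -/T -mulr_sumr; apply: ler_wpM2l; first by rewrite mulr_ge0 ?sqr_ge0.
  apply: ler_sum => zeta zf; apply: ler_wpM2l; first by rewrite addr_ge0.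
  have dn : 0 <= T - 1 - ((zeta z)%:R + 1).
    have := sum_fiber_inside F zf; rewrite (bigD1 z zS) /=.
    have : 0 <= \sum_(y in S | y != z) (zeta y)%:R :> F by apply: sumr_ge0.
    by move: sE; rewrite -[q.+1%:R]natr1 /T; lra.
  apply: ler_sum => y _; apply: ler_wpM2l; first by apply: divr_ge0 => //; rewrite addr_ge0.
  (* Passing through the common centre [C]: [(A - B)^2 <= 2 (A - C)^2 + 2 (B - C)^2]. *)
  rewrite /W; set A := f _; set B := f _; set C := c _.
  by have := sqr_ge0 (A - C + (B - C)); nra.
(* The weights [eta z + 1] sum to [T] for every [eta], so the size-biased choice of [z] does not
   distort the uniform law. *)
have sumT : \sum_(z in S) \sum_(eta in fiber S w q.+1) ((eta z)%:R + 1) * (f eta - mu) ^+ 2 =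
   T * \sum_(eta in fiber S w q.+1) (f eta - mu) ^+ 2.
  rewrite exchange_big mulr_sumr; apply: eq_bigr => eta ef.
  rewrite -mulr_suml big_split /= (sum_fiber_inside F ef) sE.
  by rewrite sumr_const.
rewrite -(ler_pM2l T0) -sumT; apply: le_trans (ler_sum _ site) _.
rewrite exchange_big /= !mulr_sumr; apply: ler_sum => zeta zf.
rewrite big_split /= -mulr_sumr.
apply: size_biased_weights => //; last 1 first.
- rewrite /a big_split /= (sum_fiber_inside F zf) sumr_const -/m.
  by move: sE; rewrite -[q.+1%:R]natr1 /T; lra.
- by move=> z _; rewrite /a lerDr.
Qed.

(** * The torus *)

(** Writing the side as [l.+3] makes ['I_l.+3] a ring and [site] an additive group, in which
    neighbours differ by plus or minus a unit vector. *)
Definition unit_site (d l : nat) (i : 'I_d) : site d l.+3 :=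
  [ffun j => if j == i then 1 else 0].

Lemma adj_unit_site (d l : nat) (x y : site d l.+3) :
  adj x y = [exists i, (y == x + unit_site l i) || (x == y + unit_site l i)].
Proof.
have step (u v : site d l.+3) i : (v == u + unit_site l i) =
    [forall j, (j != i) ==> (u j == v j)] && ((v i : nat) == ((u i).+1 %% l.+3)%N).
  apply/eqP/andP => [->|[/forallP h /eqP vi]].
    split; first by apply/forallP => j; apply/implyP => /negPf ji; rewrite !ffunE ji addr0.
    by rewrite !ffunE eqxx /= addn1.
  apply/ffunP => j; rewrite !ffunE; case: eqP => [->|/eqP ji].
    by apply: val_inj; rewrite /= vi addn1.
  by rewrite addr0; move: (h j); rewrite ji => /eqP.
rewrite /adj; apply: eq_existsb => i; rewrite !step andb_orr; congr (_ || _ && _).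
by apply: eq_forallb => j; rewrite [x j == _]eq_sym.
Qed.

Lemma adj_sym (d l : nat) (x y : site d l.+3) : adj x y = adj y x.
Proof. by rewrite !adj_unit_site; apply: eq_existsb => i; rewrite orbC. Qed.

Lemma unit_site_neq0 (d l : nat) (i : 'I_d) : unit_site l i != 0.
Proof. by apply/eqP => /ffunP /(_ i); rewrite !ffunE eqxx. Qed.

Lemma adj_neq (d l : nat) (x y : site d l.+3) : adj x y -> x != y.
Proof.
rewrite adj_unit_site => /existsP[i H]; apply/eqP => xy; move: H.
by rewrite xy orbb -{1}[y]addr0 (inj_eq (addrI y)) eq_sym (negPf (unit_site_neq0 l i)).
Qed.

Definition unit_sites (d l : nat) : {set site d l.+3} :=
  [set unit_site l i | i : 'I_d] :|: [set - unit_site l i | i : 'I_d].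

Lemma card_adj (d l : nat) (x : site d l.+3) :
  #|[set z | adj x z]| = #|unit_sites d l|.
Proof.
rewrite -(card_imset (mem (unit_sites d l)) (addrI x)); apply: eq_card => z.
rewrite inE adj_unit_site; apply/existsP/imsetP => [[i /orP[/eqP ->|/eqP ->]]|[u]].
- exists (unit_site l i) => //; rewrite inE; apply/orP; left; exact: imset_f.
- exists (- unit_site l i); last by rewrite addrK.
  by rewrite inE; apply/orP; right; apply: (imset_f (fun i => - unit_site l i)).
rewrite inE => /orP[/imsetP[i _ ->] -> |/imsetP[i _ ->] ->]; exists i; rewrite ?eqxx //.
by rewrite subrK eqxx orbT.
Qed.

Lemma card_unit_sites_le (d l : nat) : (#|unit_sites d l| <= 2 * d)%N.
Proof.
apply: leq_trans (leq_card_setU _ _) _; rewrite mul2n -addnn.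
by apply: leq_add; apply: leq_trans (leq_imset_card _ _) _; rewrite card_ord.
Qed.

Lemma card_unit_sites_gt0 (d l : nat) : (0 < d)%N -> (0 < #|unit_sites d l|)%N.
Proof.
case: d => // d _; apply/card_gt0P; exists (unit_site l ord0).
by rewrite inE; apply/orP; left; exact: imset_f.
Qed.

(** Cauchy-Schwarz along the path with steps [u i]; summing over all starting points makes the
    energy of each step independent of where it occurs on the path. *)
Lemma shift_energy_sum (F : realFieldType) (d l : nat) (g : site d l.+3 -> F)
    (I : Type) (s : seq I) (u : I -> site d l.+3) :
  \sum_(x : site d l.+3) (g (x + \sum_(i <- s) u i) - g x) ^+ 2 <=
  (size s)%:R * \sum_(i <- s) \sum_(x : site d l.+3) (g (x + u i) - g x) ^+ 2.
Proof.
elim: s => [|i s IH].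
  by rewrite !big_nil mulr0 big1 // => x _; rewrite addr0 subrr expr0n.
rewrite !big_cons /=; case: (posnP (size s)) => [/size0nil ->|s0].
  by rewrite !big_nil !addr0 mul1r.
set v := \sum_(j <- s) u j in IH *; set N : F := (size s)%:R in IH.
have N0 : 0 < N by rewrite ltr0n.
rewrite -[(size _).+1%:R]natr1 -/N -(ler_pM2l N0).
have shifted : \sum_(x : site d l.+3) (g (x + u i + v) - g (x + u i)) ^+ 2 = \sum_(x : site d l.+3) (g (x + v) - g x) ^+ 2.
  by rewrite [RHS](reindex_inj (addIr (u i))).
apply: (@le_trans _ _ ((N + 1) * (\sum_(x : site d l.+3) (g (x + u i + v) - g (x + u i)) ^+ 2
    + N * \sum_(x : site d l.+3) (g (x + u i) - g x) ^+ 2))).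
  rewrite !mulr_sumr -big_split mulr_sumr /=; apply: ler_sum => x _; rewrite addrA.
  set a := g (x + u i + v); set b := g (x + u i).
  by have := sqr_ge0 (a - b - N * (b - g x)); nra.
rewrite shifted mulrCA; apply: ler_wpM2l; first by rewrite addr_ge0 // ltW.
by rewrite mulrDr [X in _ <= X]addrC lerD2r.
Qed.

(** A coordinate path from 0 to [t], padded with zero steps so that every [t] uses the same index
    set of size [d * l.+3]. *)
Lemma site_decomposition (d l : nat) (t : site d l.+3) :
  t = \sum_(p : 'I_d * 'I_l.+3) (if (p.2 < t p.1)%N then unit_site l p.1 else 0).
Proof.
apply/ffunP => j; rewrite sum_ffunE.
rewrite -(pair_bigA _ (fun (i : 'I_d) (k : 'I_l.+3) => (if (k < t i)%N then unit_site l i else 0) j)) /=.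
rewrite (bigD1 j) //= [X in _ + X]big1 ?addr0; last first.
  by move=> i /negPf ij; apply: big1 => k _; case: ifP => _; rewrite !ffunE // eq_sym ij.
transitivity (\sum_(k < l.+3 | (k < t j)%N) (1 : 'I_l.+3)).
  rewrite sumr_const -[LHS]natr_Zp; congr (_ *+ _).
  transitivity (\sum_(k < t j) 1)%N; first by rewrite sum1_card card_ord.
  rewrite (big_ord_widen l.+3 (fun=> 1%N)); last exact: ltnW.
  by rewrite sum1_card.
rewrite big_mkcond; apply: eq_bigr => k _; case: ifP => _; by rewrite !ffunE ?eqxx.
Qed.

(** The energies [A t] of all translations add up to twice the number of sites times the variance.
    Each is at most [d L^2] times the sum over the unit translations: [d L] is the length of the
    padded path, and each direction occurs at most [L] times. *)
Lemma torus_poincare (F : realFieldType) (d l : nat) (g : site d l.+3 -> F) :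
  \sum_x (g x - (\sum_y g y) / #|site d l.+3|%:R) ^+ 2 <=
  d%:R * l.+3%:R ^+ 2 / 2 * \sum_x \sum_(y | adj x y) (g y - g x) ^+ 2.
Proof.
set n : F := #|_|%:R; set c := _ / n.
have n0 : 0 < n.
  by rewrite ltr0n; apply/card_gt0P; exists 0.
have sg : \sum_y g y = n * c by rewrite /c mulrC mulfVK // gt_eqF.
have cst (k : F) : \sum_(y : site d l.+3) k = n * k by rewrite sumr_const -mulr_natl.
pose A (t : site d l.+3) := \sum_(x : site d l.+3) (g (x + t) - g x) ^+ 2.
have A0 t : 0 <= A t by apply: sumr_ge0 => x _; exact: sqr_ge0.
have dbl : \sum_t A t = 2 * n * \sum_x (g x - c) ^+ 2.
  transitivity (\sum_x \sum_y (g y - g x) ^+ 2).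
    rewrite exchange_big; apply: eq_bigr => x _.
    by rewrite [RHS](reindex_inj (addrI x)).
  transitivity (\sum_x (\sum_y (g y - c) ^+ 2 + n * (g x - c) ^+ 2
     - 2 * (g x - c) * (\sum_y g y - n * c))).
    apply: eq_bigr => x _; rewrite -!cst -sumrB mulr_sumr -big_split -sumrB /=.
    by apply: eq_bigr => y _; ring.
  under eq_bigr do rewrite sg subrr mulr0 subr0.
  by rewrite big_split /= cst -mulr_sumr; ring.
have Ale t : A t <= d%:R * l.+3%:R ^+ 2 * \sum_i A (unit_site l i).
  have := shift_energy_sum g (index_enum (('I_d * 'I_l.+3)%type : finType))
    (fun p => if (p.2 < t p.1)%N then unit_site l p.1 else 0).
  rewrite -site_decomposition -/(A t) => /le_trans; apply.
  have -> : size (index_enum (('I_d * 'I_l.+3)%type : finType)) = (d * l.+3)%N.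
    by rewrite -[size _]sum1_size sum1_card card_prod !card_ord.
  rewrite natrM -mulrA expr2 -!mulrA; apply: ler_wpM2l => //; apply: ler_wpM2l => //.
  rewrite mulr_sumr -(pair_bigA _ (fun (i : 'I_d) (k : 'I_l.+3) => A (if (k < t i)%N then unit_site l i else 0))) /=.
  apply: ler_sum => i _.
  apply: (@le_trans _ _ (\sum_(k < l.+3) A (unit_site l i))).
    apply: ler_sum => k _; case: ifP => // _.
    rewrite {1}/A big1; last by move=> x _; rewrite addr0 subrr expr0n.
    exact: A0.
  by rewrite sumr_const card_ord mulr_natl.
have Eadj : \sum_i A (unit_site l i) <= \sum_x \sum_(y | adj x y) (g y - g x) ^+ 2.
  rewrite exchange_big; apply: ler_sum => x _.
  have inj : injective (fun i : 'I_d => x + unit_site l i).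
    move=> i j /addrI /ffunP /(_ i); rewrite !ffunE eqxx; case: eqP => //.
  rewrite -(big_imset (fun y => (g y - g x) ^+ 2) (in2W inj)) /=.
  rewrite [X in X <= _]big_mkcond [X in _ <= X]big_mkcond; apply: ler_sum => y _.
  case: imsetP => [[i _ ->]|_]; last by case: ifP; rewrite ?sqr_ge0.
  suff -> : adj x (x + unit_site l i) by [].
  by rewrite adj_unit_site; apply/existsP; exists i; rewrite eqxx.
have : 2 * n * \sum_x (g x - c) ^+ 2 <= n * (d%:R * l.+3%:R ^+ 2 *
   \sum_x \sum_(y | adj x y) (g y - g x) ^+ 2).
  rewrite -dbl -cst; apply: ler_sum => t _; apply: le_trans (Ale t) _.
  by apply: ler_wpM2l => //; rewrite mulr_ge0 ?sqr_ge0.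
rewrite -mulrA mulrCA ler_pM2l //; lra.
Qed.

(** * The zero range process *)

Lemma mem_configs (d l q : nat) (w : config d l.+3 q.+1) t eta :
  (eta \in fiber [set: site d l.+3] w t) = (\sum_x (eta x : nat) == t)%N.
Proof.
rewrite inE andbC (_ : [forall z in _, _] = true) //.
by apply/forallP => z; rewrite !inE.
Qed.

Lemma configsE (d l q : nat) (w : config d l.+3 q.+1) :
  configs d l.+3 q.+1 = fiber [set: site d l.+3] w q.+1.
Proof. by apply/setP => eta; rewrite mem_configs inE. Qed.

(** The centre of [fiber_variance] is taken to be the spatial mean of [x |-> f (zeta + delta_x)],
    and the torus inequality is applied for each [zeta]; its factor 1/2 turns 1280 into 640. *)
Lemma configs_poincare (F : realFieldType) (d l q : nat) (w : config d l.+3 q.+1)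
    (f : config d l.+3 q.+1 -> F) mu :
  \sum_(eta in configs d l.+3 q.+1) (f eta - mu) = 0 ->
  \sum_(eta in configs d l.+3 q.+1) (f eta - mu) ^+ 2 <=
  640 * (q.+1%:R / (l.+3 ^ d)%:R + 1) ^+ 2 * (d%:R * l.+3%:R ^+ 2) *
    \sum_(zeta in fiber [set: site d l.+3] w q) \sum_x \sum_(y | adj x y)
      (f (add_particle zeta y) - f (add_particle zeta x)) ^+ 2.
Proof.
rewrite (configsE w) => cen.
have ws : (\sum_(y in ~: [set: site d l.+3]) (w y : nat) + q.+1 = q.+1)%N.
  by rewrite big_pred0 // => y; rewrite !inE.
pose c (zeta : config d l.+3 q.+1) := (\sum_y f (add_particle zeta y)) / #|site d l.+3|%:R.
have := fiber_variance c ws cen; rewrite cardsT card_ffun !card_ord.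
have -> : (q.+1%:R + (l.+3 ^ d)%:R) / (l.+3 ^ d)%:R = q.+1%:R / (l.+3 ^ d)%:R + 1 :> F.
  by rewrite mulrDl divff // pnatr_eq0 expn_eq0.
move/le_trans; apply; rewrite -[X in _ <= X]mulrA.
have -> : 1280 * (q.+1%:R / (l.+3 ^ d)%:R + 1) ^+ 2 =
   640 * (q.+1%:R / (l.+3 ^ d)%:R + 1) ^+ 2 * 2 :> F by ring.
rewrite -mulrA; apply: ler_wpM2l; first by rewrite mulr_ge0 ?sqr_ge0.
rewrite !mulr_sumr; apply: ler_sum => zeta _.
rewrite (eq_bigl predT) => [|x]; last by rewrite !inE.
have := torus_poincare (fun x => f (add_particle zeta x)); rewrite -/(c zeta).
lra.
Qed.

Lemma move_add_particle (d l q : nat) (w zeta : config d l.+3 q.+1) (x y : site d l.+3) :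
  adj x y -> zeta \in fiber [set: site d l.+3] w q ->
  move (add_particle zeta x) x y = add_particle zeta y.
Proof.
move=> xy; rewrite mem_configs => /eqP sm.
have lt : (\sum_z (zeta z : nat) < q.+1)%N by rewrite sm.
have nxy := adj_neq xy.
apply/ffunP => z; apply: val_inj; rewrite ffunE /= !add_particleE //.
have xle := occupation_le zeta x; have yle := occupation_le zeta y; rewrite !sm in xle yle.
case: (eqVneq z x) => [->|zx].
  by rewrite eqxx (negPf nxy) addn1 addn0 inordK //= ltnS leqW.
case: (eqVneq z y) => [->|zy].
  by rewrite eq_sym (negPf nxy) addn0 addn1 inordK // !ltnS.
by rewrite add_particleE // (negPf zx).
Qed.

Lemma card_adj_classical (d l : nat) (x : site d l.+3) :
  #|[set z | adj x z]%classic| = #|unit_sites d l|.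
Proof.
rewrite -(card_adj x); apply: eq_card => z; rewrite [RHS]inE.
by apply/idP/idP; rewrite in_setE.
Qed.

(** An occupied site emits at rate 1 whatever its occupation number, so each pair of [zeta] and edge
    is counted once with the same weight. This is why the uniform law is the relevant one. *)
Lemma sum_zrp_rate (d l q : nat) (w : config d l.+3 q.+1)
    (G : config d l.+3 q.+1 -> config d l.+3 q.+1 -> R) :
  \sum_(eta in configs d l.+3 q.+1) \sum_xi zrp_rate eta xi * G eta xi =
  #|unit_sites d l|%:R^-1 *
    \sum_(zeta in fiber [set: site d l.+3] w q) \sum_x \sum_(y | adj x y)
      G (add_particle zeta x) (add_particle zeta y).
Proof.
set k : R := _^-1.
transitivity (\sum_(eta in configs d l.+3 q.+1) \sum_x \sum_(y | adj x y && (0 < eta x)%N)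
    k * G eta (move eta x y)).
  apply: eq_bigr => eta _; rewrite /zrp_rate.
  under eq_bigr do rewrite mulr_suml.
  rewrite exchange_big /=; apply: eq_bigr => x _.
  under eq_bigr do rewrite mulr_suml card_adj_classical -/k.
  rewrite (exchange_big_dep (fun y => adj x y && (0 < eta x)%N)) /=; last first.
    by move=> xi y _ /and3P[-> ->].
  apply: eq_bigr => y /andP[xy pos].
  rewrite (eq_bigl (pred1 (move eta x y))) ?big_pred1_eq // => xi.
  by rewrite xy pos /= eq_sym.
rewrite exchange_big [in RHS]exchange_big mulr_sumr /=; apply: eq_bigr => x _.
rewrite [in RHS]exchange_big mulr_sumr /=.
transitivity (\sum_(y | adj x y) \sum_(eta in configs d l.+3 q.+1 | (0 < eta x)%N)
    k * G eta (move eta x y)).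
  rewrite (exchange_big_dep (adj x)) /=; last by move=> ? ? _ /andP[].
  by apply: eq_bigr => y xy; apply: eq_bigl => eta; rewrite xy.
apply: eq_bigr => y xy; rewrite (configsE w) sum_fiber_shift ?inE // mulr_sumr.
by apply: eq_bigr => zeta zf; rewrite (move_add_particle xy zf).
Qed.

Lemma sum_adj_sym (d l : nat) (G : site d l.+3 -> site d l.+3 -> R) :
  \sum_x \sum_(y | adj x y) G x y = \sum_x \sum_(y | adj x y) G y x.
Proof.
rewrite (exchange_big_dep predT) //=; apply: eq_bigr => x _.
by apply: eq_bigl => y; rewrite adj_sym.
Qed.

(* Pairing the balance equation with [pi] itself shows that the Dirichlet form of
   [pi] vanishes, so [configs_poincare] gives uniqueness without a connectivity
   argument. *)
Lemma stationary_constant (d l q : nat) (pi : config d l.+3 q.+1 -> R) :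
  (0 < d)%N -> stationary pi ->
  exists2 c, 0 < c & [/\ c * #|configs d l.+3 q.+1|%:R = 1 &
    forall eta, pi eta = if eta \in configs d l.+3 q.+1 then c else 0].
Proof.
move=> d0 [pi0 out tot bal]; set C := configs d l.+3 q.+1 in out *.
pose w : config d l.+3 q.+1 := [ffun=> ord0].
pose k : R := #|unit_sites d l|%:R^-1.
have k0 : 0 < k by rewrite invr_gt0 ltr0n card_unit_sites_gt0.
pose B := fiber [set: site d l.+3] w q.
have onC (G : config d l.+3 q.+1 -> R) : \sum_eta pi eta * G eta = \sum_(eta in C) pi eta * G eta.
  rewrite [RHS]big_mkcond; apply: eq_bigr => eta _; case: ifPn => // /out ->.
  by rewrite mul0r.
(* The balance equation paired with [pi]: [e1] expands the inflow, [e2] the outflow. Their equality,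
   symmetrized over the edges, gives [D0]. *)
have e1 : \sum_xi pi xi * (\sum_eta pi eta * zrp_rate eta xi) =
   k * \sum_(zeta in B) \sum_x \sum_(y | adj x y) pi (add_particle zeta x) * pi (add_particle zeta y).
  rewrite -(sum_zrp_rate w (fun eta xi => pi eta * pi xi)).
  under eq_bigr do rewrite mulr_sumr.
  rewrite exchange_big /=; transitivity (\sum_eta pi eta * \sum_xi zrp_rate eta xi * pi xi).
    by apply: eq_bigr => eta _; rewrite mulr_sumr; apply: eq_bigr => xi _; ring.
  rewrite onC; apply: eq_bigr => eta _; rewrite mulr_sumr; apply: eq_bigr => xi _; ring.
have e2 : \sum_xi pi xi * (\sum_eta pi eta * zrp_rate eta xi) =
   k * \sum_(zeta in B) \sum_x \sum_(y | adj x y) pi (add_particle zeta x) ^+ 2.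
  rewrite -(sum_zrp_rate w (fun eta xi => pi eta ^+ 2)).
  under eq_bigr do rewrite bal.
  rewrite onC; apply: eq_bigr => eta _; rewrite !mulr_sumr; apply: eq_bigr => xi _; ring.
have D0 : \sum_(zeta in B) \sum_x \sum_(y | adj x y)
    (pi (add_particle zeta y) - pi (add_particle zeta x)) ^+ 2 = 0.
  transitivity (2 * (\sum_(zeta in B) \sum_x \sum_(y | adj x y) pi (add_particle zeta x) ^+ 2
     - \sum_(zeta in B) \sum_x \sum_(y | adj x y) pi (add_particle zeta x) * pi (add_particle zeta y))).
    rewrite -sumrB mulr_sumr; apply: eq_bigr => zeta _.
    transitivity (\sum_x \sum_(y | adj x y) pi (add_particle zeta y) ^+ 2
      + \sum_x \sum_(y | adj x y) pi (add_particle zeta x) ^+ 2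
      - 2 * \sum_x \sum_(y | adj x y) pi (add_particle zeta x) * pi (add_particle zeta y)).
      rewrite mulr_sumr -big_split -sumrB /=; apply: eq_bigr => x _.
      rewrite mulr_sumr -big_split -sumrB /=; apply: eq_bigr => y _; ring.
    rewrite [X in X + _ - _](sum_adj_sym (fun x y => pi (add_particle zeta y) ^+ 2)).
    by ring.
  have := e2; rewrite e1 => /(mulfI (lt0r_neq0 k0)) ->; by rewrite subrr mulr0.
have C0 : (0 < #|C|)%N.
  rewrite lt0n; apply/negP => /eqP/cards0_eq Ce; move: tot.
  rewrite big1 => [/esym/eqP|eta _]; first by rewrite oner_eq0.
  by apply: out; rewrite Ce inE.
have Cn : #|C|%:R != 0 :> R by rewrite pnatr_eq0 -lt0n.
have totC : \sum_(eta in C) pi eta = 1.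
  by rewrite -tot [LHS]big_mkcond; apply: eq_bigr => eta _; case: ifPn => // /out ->.
have cen : \sum_(eta in C) (pi eta - #|C|%:R^-1) = 0.
  by rewrite sumrB totC sumr_const -[X in _ - X]mulr_natl divff // subrr.
have := configs_poincare w cen; rewrite D0 mulr0 => le0.
have eqC eta : eta \in C -> pi eta = #|C|%:R^-1.
  move=> eC; apply/eqP; rewrite -subr_eq0 -sqrf_eq0; apply/eqP.
  apply: (psumr_eq0P (P := mem C) (F := fun eta => (pi eta - #|C|%:R^-1) ^+ 2)) => //.
    by move=> ? _; exact: sqr_ge0.
  apply/eqP; rewrite eq_le le0 /=; apply: sumr_ge0 => ? _; exact: sqr_ge0.
exists #|C|%:R^-1; first by rewrite invr_gt0 ltr0n.
split; first by rewrite mulVf.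
by move=> eta; case: ifPn => [/eqC|/out].
Qed.

Lemma variance_dirichlet (d l q : nat) (pi f : config d l.+3 q.+1 -> R) :
  (0 < d)%N -> stationary pi ->
  variance pi f <=
  2560 * d%:R ^+ 2 * (q.+1%:R / (l.+3 ^ d)%:R + 1) ^+ 2 * l.+3%:R ^+ 2 * dirichlet pi f.
Proof.
move=> d0 /(stationary_constant d0)[c c0 [cC piE]].
set C := configs d l.+3 q.+1 in cC piE.
pose w : config d l.+3 q.+1 := [ffun=> ord0].
have onC (G : config d l.+3 q.+1 -> R) : \sum_eta pi eta * G eta = c * \sum_(eta in C) G eta.
  rewrite mulr_sumr [RHS]big_mkcond; apply: eq_bigr => eta _; rewrite piE.
  by case: ifP; rewrite ?mul0r.
set mu := expect pi f.
have cen : \sum_(eta in C) (f eta - mu) = 0.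
  rewrite sumrB sumr_const /mu /expect onC -[X in _ - X]mulr_natl mulrA [_ * c]mulrC cC mul1r.
  by rewrite subrr.
have := configs_poincare w cen; set E := \sum_(zeta in _) _; set h := q.+1%:R / _ + 1 => P.
set D : R := #|unit_sites d l|%:R.
have D0 : 0 < D by rewrite ltr0n card_unit_sites_gt0.
have Dd : D <= 2 * d%:R by rewrite -natrM ler_nat card_unit_sites_le.
have dirE : dirichlet pi f = c * (2^-1 * (D^-1 * E)).
  rewrite /dirichlet -(sum_zrp_rate w (fun eta xi => (f xi - f eta) ^+ 2)).
  transitivity (2^-1 * \sum_eta pi eta * \sum_xi zrp_rate eta xi * (f xi - f eta) ^+ 2).
    by congr (_ * _); apply: eq_bigr => eta _; rewrite mulr_sumr; apply: eq_bigr => xi _; rewrite mulrA.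
  by rewrite onC mulrCA.
have E0 : 0 <= E.
  by apply: sumr_ge0 => zeta _; apply: sumr_ge0 => x _; apply: sumr_ge0 => y _; exact: sqr_ge0.
rewrite /variance onC dirE.
apply: le_trans (ler_wpM2l (ltW c0) P) _.
rewrite [X in _ <= X]mulrCA; apply: ler_wpM2l; first exact: ltW.
set A := 640 * h ^+ 2 * (d%:R * l.+3%:R ^+ 2).
have A0 : 0 <= A by apply: mulr_ge0; apply: mulr_ge0; rewrite ?sqr_ge0.
(* The constant is [640 * 2 * 2]: one 2 undoes the half in [dirichlet], the other comes from the
   degree bound [D <= 2 d], which also supplies the second factor [d]. *)
have -> : 2560 * d%:R ^+ 2 * h ^+ 2 * l.+3%:R ^+ 2 * (2^-1 * (D^-1 * E)) =
   A * E * (2 * d%:R / D) by rewrite /A; field; exact: lt0r_neq0.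
rewrite -[X in X <= _]mulr1; apply: ler_wpM2l; first by apply: mulr_ge0.
by rewrite ler_pdivlMr // mul1r.
Qed.

(** Bounding the infimum in [spectral_gap] from below requires a test function. The indicator of all
    particles piled at one site serves, since piles at two different sites are both charged by
    [pi]. *)
Lemma exists_variance_gt0 (d l q : nat) (pi : config d l.+3 q.+1 -> R) :
  (0 < d)%N -> stationary pi -> exists f, 0 < variance pi f.
Proof.
move=> d0 /(stationary_constant d0)[c c0 [cC piE]].
pose pile (x : site d l.+3) : config d l.+3 q.+1 := [ffun z => if z == x then ord_max else ord0].
have pileC x : pile x \in configs d l.+3 q.+1.
  rewrite inE (bigD1 x) //= big1 => [|z /negPf zx]; rewrite !ffunE ?eqxx ?addn0 //.
  by rewrite zx.
case: d d0 pi piE @pile pileC cC => // d _ pi piE pile pileC cC.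
pose f eta : R := (eta == pile 0)%:R.
exists f; set mu := expect pi f.
have pi0 eta : 0 <= pi eta by rewrite piE; case: ifP => // _; exact: ltW.
have t0 eta : 0 <= pi eta * (f eta - mu) ^+ 2 by rewrite mulr_ge0 ?sqr_ge0.
rewrite lt0r; apply/andP; split; last exact: sumr_ge0.
apply/eqP => V0.
have z eta : eta \in configs d.+1 l.+3 q.+1 -> f eta = mu.
  move=> eC; have /eqP := @psumr_eq0P _ _ predT (fun eta => pi eta * (f eta - mu) ^+ 2) (fun e _ => t0 e) V0 eta isT.
  by rewrite piE eC mulf_eq0 gt_eqF //= sqrf_eq0 subr_eq0 => /eqP.
have := z _ (pileC 0); rewrite -(z _ (pileC (unit_site l ord0))) /f eqxx.
case: eqP => [|_ /eqP]; last by rewrite oner_eq0.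
move/ffunP/(_ 0); rewrite !ffunE eqxx eq_sym (negPf (unit_site_neq0 l _)).
by move/(congr1 val).
Qed.

Theorem mainTheorem1 :
  exists C : R, 0 < C /\
  forall (d L r : nat), (1 <= d)%N -> (3 <= L)%N -> (1 <= r)%N ->
  forall pi : config d L r -> R, stationary pi ->
  let rho : R := r%:R / (L ^ d)%:R in
  0 < spectral_gap pi /\
  relaxation_time pi <= C * (d%:R) ^+ 2 * (rho + 1) ^+ 2 * (L%:R) ^+ 2.
Proof.
exists 2560%:R; split=> // d [|[|[|l]]] // [|q] // d0 _ _ pi st rho.
set K := 2560 * d%:R ^+ 2 * (rho + 1) ^+ 2 * l.+3%:R ^+ 2.
have K0 : 0 < K.
  have rho0 : 0 < rho + 1 by rewrite ltr_wpDl // divr_ge0.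
  have sq (x : R) : 0 < x -> 0 < x ^+ 2 by exact: exprn_gt0.
  apply: mulr_gt0; last exact/sq/ltr0Sn.
  apply: mulr_gt0; last exact: sq.
  by apply: mulr_gt0; [rewrite ltr0n|apply: sq; rewrite ltr0n].
have gap : K^-1 <= spectral_gap pi.
  have [f0 v0] := exists_variance_gt0 d0 st.
  apply: lb_le_inf; first by exists (dirichlet pi f0 / variance pi f0); exists f0.
  move=> _ [f /= vf <-]; rewrite ler_pdivlMr // mulrC ler_pdivrMr //.
  by rewrite mulrC; exact: variance_dirichlet.
have gap0 : 0 < spectral_gap pi by apply: lt_le_trans gap; rewrite invr_gt0.
split=> //; rewrite /relaxation_time -[leRHS]invrK lef_pV2 ?posrE ?invr_gt0 //.
Qed.
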